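(* Let $\psi_1,\dots,\psi_N$ and $\mathcal L^{e_i}_{\mathbb V},\tilde{\mathcal L}^{e_i}_m\in\mathbb R^{N\times N}$ ($i=0,\dots,n_c$) be as in the context, where the data satisfy (iid) or (erg) of the context. Let $T,\varepsilon>0$, $\delta\in(0,1)$, $z_0\in\mathbb R^N$, and let $u=\sum_{i=1}^{n_c}\alpha_ie_i\in L^\infty(0,T;\mathbb R^{n_c})$ be such that the solution of the control system (from the given initial state in $\mathbb X$) with control $u$ is contained in $\mathbb X$ with probability one. Set $$\mathcal L^u_{\mathbb V}(t)=\mathcal L^0_{\mathbb V}+\sum_{i=1}^{n_c}\alpha_i(t)\big(\mathcal L^{e_i}_{\mathbb V}-\mathcal L^0_{\mathbb V}\big),\qquad \tilde{\mathcal L}^u_m(t)=\tilde{\mathcal L}^0_m+\sum_{i=1}^{n_c}\alpha_i(t)\big(\tilde{\mathcal L}^{e_i}_m-\tilde{\mathcal L}^0_m\big).$$ Then there is $m_0\in\mathbb N$ such that for all $m\ge m_0$ the solutions $z,\tilde z$ of $$\dot z(t)=\mathcal L^u_{\mathbb V}(t)z(t),\quad z(0)=z_0,\qquad\qquad\dot{\tilde z}(t)=\tilde{\mathcal L}^u_m(t)\tilde z(t),\quad\tilde z(0)=z_0,$$ satisfy $$\min_{t\in[0,T]}\mathbb P\big(\|z(t)-\tilde z(t)\|_2\le\varepsilon\big)\ge1-\delta,$$ i.e. $\mathbb P(\|z(t)-\tilde z(t)\|_2\le\varepsilon)\ge1-\delta$ for every $t\in[0,T]$.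
   Context: Control system: $\mathrm dX_t=\big(F(X_t)+\sum_{i=1}^{n_c}G_i(X_t)u_i\big)\mathrm dt+\sigma(X_t)\,\mathrm dW_t$ with state in $\mathbb X\subset\mathbb R^n$, input $u\in\mathbb R^{n_c}$, locally Lipschitz vector fields $F,G_i:\mathbb X\to\mathbb R^n$ ($\sigma\equiv0$ allowed). $e_1,\dots,e_{n_c}$ are the standard basis vectors of $\mathbb R^{n_c}$, $e_0:=0$, $G_0:=0$; superscripts $0$ and $e_0$ mean the same. For $i=0,\dots,n_c$, consider the autonomous system with constant control $u\equiv e_i$; $\mathcal K_i^t f(x)=\mathbb E[f(X_t)\mid X_0=x]$ is its Koopman semigroup and $\mathcal L^{e_i}$ its generator in $L^2_{\mu_i}(\mathbb X)$, acting on smooth functions as $(F+G_i)\cdot\nabla+\frac12\sigma\sigma^\top:\nabla^2$ ($A:B=\sum_{jk}a_{jk}b_{jk}$). A probability measure $\mu_i$ is invariant for the $i$-th system if $\int\mathcal K_i^tf\,\mathrm d\mu_i=\int f\,\mathrm d\mu_i$ for all bounded measurable $f$, $t\ge0$. Data: for each $i=0,\dots,n_c$ there are $m$ points $x^{(i)}_0,\dots,x^{(i)}_{m-1}\in\mathbb X$ satisfying one of: (iid) they are drawn i.i.d. either from $\mu_i$ = normalized Lebesgue measure on a compact set $\mathbb X$ (forward invariance of $\mathbb X$ is not assumed; here $\mathcal L^{e_i}$ is understood as the differential operator $(F+G_i)\cdot\nabla+\frac12\sigma\sigma^\top:\nabla^2$, with $D(\mathcal L^{e_i})$ the functions on which it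 yields an element of $L^2_{\mu_i}(\mathbb X)$), or from an invariant measure $\mu_i$ of the $i$-th system; (erg) $\mu_i$ is the unique invariant measure of the $i$-th system, $x^{(i)}_k=X_{k\Delta_t}$ along a single trajectory of the $i$-th system with $X_0\sim\mu_i$, $\Delta_t>0$, and $\|\mathcal K_i^t\|\le M_ie^{-\omega_it}$ on $L^2_{\mu_i,0}(\mathbb X)=\{f\in L^2_{\mu_i}(\mathbb X):\int f\,\mathrm d\mu_i=0\}$ for all $t\ge0$, with $M_i\ge1$, $\omega_i>0$. Observables: $\psi_1,\dots,\psi_N:\mathbb X\to\mathbb R$ are linearly independent (in each $L^2_{\mu_i}(\mathbb X)$) with $\mathbb V=\mathrm{span}\{\psi_j\}\subset\bigcap_{i=0}^{n_c}D(\mathcal L^{e_i})$. Let $\Psi=(\psi_1,\dots,\psi_N)^\top$ and let $\mathcal L^{e_i}$ act on $\Psi$ entrywise. $C^{(i)}_{jk}=\langle\psi_j,\psi_k\rangle_{L^2_{\mu_i}}$, $A^{(i)}_{jk}=\langle\psi_j,\mathcal L^{e_i}\psi_k\rangle_{L^2_{\mu_i}}$, $\mathcal L^{e_i}_{\mathbb V}=(C^{(i)})^{-1}A^{(i)}$; $\tilde C^{(i)}_m=\frac1m\sum_{k=0}^{m-1}\Psi(x^{(i)}_k)\Psi(x^{(i)}_k)^\top$, $\tilde A^{(i)}_m=\frac1m\sum_{k=0}^{m-1}\Psi(x^{(i)}_k)(\mathcal L^{e_i}\Psi)(x^{(i)}_k)^\top$, $\tilde{\mathcal L}^{e_i}_m=(\tilde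 C^{(i)}_m)^{-1}\tilde A^{(i)}_m$ (the event in the claim includes invertibility of all $\tilde C^{(i)}_m$). *)

(* Defs.v *)
From mathcomp Require Import all_boot all_order all_algebra.
From mathcomp Require Import all_classical all_reals all_analysis.

Set Implicit Arguments.
Unset Strict Implicit.
Unset Printing Implicit Defensive.

Import Order.TTheory GRing.Theory Num.Theory.
Import numFieldNormedType.Exports.

Local Open Scope classical_set_scope.
Local Open Scope ring_scope.

(* R^n with its Borel sigma-algebra; convertible to 'rV[R]_n. *)
Notation Rn R n := (g_sigma_algebraType (@open 'rV[R]_n)).

Definition norm2 (R : realType) (N : nat) (v : 'cV[R]_N) : R :=
  Num.sqrt (\sum_j v j ord0 ^+ 2).

Section Stochastics.
Context {R : realType} {d : measure_display} {Omega : measurableType d}.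
Variable P : probability Omega R.

(* Convergence to 0 in probability of nonnegative functions. The measurable
   sets E k make sense of P(Y_k >= e) --> 0 without assuming Y_k measurable. *)
Definition cvg_prob0 (Y : nat -> Omega -> \bar R) : Prop :=
  forall e : R, 0 < e -> exists E : nat -> set Omega,
    [/\ forall k, measurable (E k),
        forall k, [set w | e%:E <= Y k w]%E `<=` E k &
        P (E k) @[k --> \oo] --> 0%E].

Definition filtration (Fil : R -> set (set Omega)) : Prop :=
  [/\ forall t, 0 <= t -> sigma_algebra setT (Fil t),
      forall t, 0 <= t -> Fil t `<=` measurable &
      forall s t, 0 <= s -> s <= t -> Fil s `<=` Fil t].

Definition measurable_for (S : set (set Omega)) (n : nat)
    (Y : Omega -> 'rV[R]_n) : Prop :=
  forall B : set (Rn R n), measurable B -> S (Y @^-1` B).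

(* Standard q-dimensional Brownian motion relative to Fil. The last clause
   says that W t - W s is independent of Fil s with law N(0, (t - s) I);
   the second parameter of normal_prob is the standard deviation. *)
Definition brownian (q : nat) (Fil : R -> set (set Omega))
    (W : R -> Omega -> 'rV[R]_q) : Prop :=
  [/\ {ae P, forall w, W 0 w = 0},
      {ae P, forall w, {within `[0, +oo[, continuous (fun t => W t w)}},
      forall t, 0 <= t -> measurable_for (Fil t) (W t) &
      forall s t, 0 <= s -> s < t ->
      forall (A : set Omega) (B : 'I_q -> set R),
        Fil s A -> (forall l, measurable (B l)) ->
        P (A `&` [set w | forall l, B l ((W t w - W s w) ord0 l)]) =
        (P A * \prod_(l < q) normal_prob 0 (Num.sqrt (t - s)) (B l))%E].

(* The process sum_(j < sp_size) sp_val j * 1_(sp_time j, sp_time j.+1]. *)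
Record simple_process (q : nat) := SimpleProcess {
  sp_size : nat;
  sp_time : nat -> R;
  sp_val : nat -> Omega -> 'rV[R]_q }.

Definition sp_valid (q : nat) (Fil : R -> set (set Omega))
    (S : simple_process q) : Prop :=
  [/\ forall j, 0 <= sp_time S j <= sp_time S j.+1,
      forall j, measurable_for (Fil (sp_time S j)) (sp_val S j) &
      forall j, exists C : R, forall w, `|sp_val S j w| <= C].

Definition sp_eval (q : nat) (S : simple_process q) (s : R) (w : Omega) :
    'rV[R]_q :=
  \sum_(j < sp_size S)
    if sp_time S j < s <= sp_time S j.+1 then sp_val S j w else 0.

(* int_0^t S . dW *)
Definition sp_int (q : nat) (W : R -> Omega -> 'rV[R]_q)
    (S : simple_process q) (t : R) (w : Omega) : R :=
  \sum_(j < sp_size S) \sum_(l < q) sp_val S j w ord0 l *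
    (W (Num.min (sp_time S j.+1) t) w ord0 l -
     W (Num.min (sp_time S j) t) w ord0 l).

(* J t is the Ito integral int_0^t H . dW for all t in I: the limit in
   probability of the integrals of simple processes S k approximating H, i.e.,
   such that int_0^t |S k - H|^2 ds --> 0 in probability. *)
Definition ito_integral (q : nat) (Fil : R -> set (set Omega))
    (W : R -> Omega -> 'rV[R]_q) (I : set R)
    (H : R -> Omega -> 'rV[R]_q) (J : R -> Omega -> R) : Prop :=
  {ae P, forall w, forall l, measurable_fun I (fun s => H s w ord0 l)} /\
  exists S : nat -> simple_process q,
    [/\ forall k, sp_valid Fil (S k),
        forall t, I t -> cvg_prob0 (fun k w =>
          (\int[lebesgue_measure]_(s in `[0%R, t])
            (\sum_(l < q) (sp_eval (S k) s w - H s w) ord0 l ^+ 2)%:E)%E) &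
        forall t, I t -> cvg_prob0 (fun k w =>
          `|sp_int W (S k) t w - J t w|%:E)].

(* X solves dX = b(t, X) dt + sigma(X) dW on the time interval I, where
   0 \in I. *)
Definition sde_solution (n q : nat) (Fil : R -> set (set Omega))
    (W : R -> Omega -> 'rV[R]_q) (I : set R)
    (b : R -> 'rV[R]_n -> 'rV[R]_n) (sigma : 'rV[R]_n -> 'M[R]_(n, q))
    (X : R -> Omega -> 'rV[R]_n) : Prop :=
  [/\ filtration Fil /\ brownian Fil W,
      forall t, I t -> measurable_for (Fil t) (X t),
      {ae P, forall w, {within I, continuous (fun t => X t w)}},
      {ae P, forall w, forall t, I t -> forall j,
        lebesgue_measure.-integrable `[0, t]
          (fun s => (b s (X s w) ord0 j)%:E)} &
      forall j : 'I_n,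
        ito_integral Fil W I (fun s w => row j (sigma (X s w)))
          (fun t w => X t w ord0 j - X 0 w ord0 j
             - \int[lebesgue_measure]_(s in `[0, t]) b s (X s w) ord0 j)].

Definition stays_in (n : nat) (I : set R) (XX : set 'rV[R]_n)
    (X : R -> Omega -> 'rV[R]_n) : Prop :=
  {ae P, forall w, forall t, I t -> XX (X t w)}.

Definition has_law (n : nat) (Y : Omega -> 'rV[R]_n)
    (mu : probability (Rn R n) R) : Prop :=
  measurable_fun setT (Y : Omega -> Rn R n) /\
  forall B : set (Rn R n), measurable B -> P (Y @^-1` B) = mu B.

Definition iid (n m : nat) (mu : probability (Rn R n) R)
    (x : 'I_m -> Omega -> 'rV[R]_n) : Prop :=
  (forall k, has_law (x k) mu) /\
  forall B : 'I_m -> set (Rn R n), (forall k, measurable (B k)) ->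
    P [set w | forall k, B k (x k w)] = (\prod_(k < m) P (x k @^-1` B k))%E.

End Stochastics.

Section ControlSystem.
Context {R : realType} {n nc q : nat}.
Variables (XX : set 'rV[R]_n) (F : 'rV[R]_n -> 'rV[R]_n)
  (G : 'I_nc -> 'rV[R]_n -> 'rV[R]_n) (sigma : 'rV[R]_n -> 'M[R]_(n, q)).

Definition control_drift (u : 'rV[R]_nc) (x : 'rV[R]_n) : 'rV[R]_n :=
  F x + \sum_(i < nc) u ord0 i *: G i x.

(* e_0 = 0 and e_(i + 1) is the i-th standard basis vector (i counted from 0) *)
Definition basis_control (i : 'I_nc.+1) : 'rV[R]_nc :=
  if unlift ord0 i is Some j then delta_mx ord0 j else 0.

Definition admissible_control (T : R) (x0 : 'rV[R]_n) (u : R -> 'rV[R]_nc) :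
    Prop :=
  (forall i, (fun t => u t ord0 i) \_ `[0, T] \in
     Lfun (@lebesgue_measure R) +oo%E) /\
  exists (d : measure_display) (Omega : measurableType d)
      (P : probability Omega R) (Fil : R -> set (set Omega))
      (W : R -> Omega -> 'rV[R]_q) (X : R -> Omega -> 'rV[R]_n),
    [/\ sde_solution P Fil W `[0, T] (fun t => control_drift (u t)) sigma X,
        {ae P, forall w, X 0 w = x0} &
        stays_in P `[0, T] XX X].

End ControlSystem.

Section Generator.
Context {R : realType} {n q : nat}.
Variable XX : set 'rV[R]_n.

Definition norm_L2 (mu : probability (Rn R n) R) (f : 'rV[R]_n -> R) : \bar R :=
  ('N[mu]_2%:E [EFin \o (f \_ XX)])%E.

(* L^2_mu(XX), for (representatives of) functions on XX arbitrarily extended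
   to R^n *)
Definition in_L2 (mu : probability (Rn R n) R) (f : 'rV[R]_n -> R) : Prop :=
  (f : Rn R n -> R) \_ XX \in Lfun mu 2%:E.

Definition inner_L2 (mu : probability (Rn R n) R) (f g : 'rV[R]_n -> R) : R :=
  \int[mu]_(x in XX) (f x * g x).

Definition free_in_L2 (mu : probability (Rn R n) R) (N : nat)
    (psi : 'I_N -> 'rV[R]_n -> R) : Prop :=
  forall c : 'I_N -> R,
    {ae mu, forall x, XX x -> \sum_(j < N) c j * psi j x = 0} ->
    forall j, c j = 0.

Variables (b : 'rV[R]_n -> 'rV[R]_n) (sigma : 'rV[R]_n -> 'M[R]_(n, q)).

(* K t is a family of transition probabilities on XX of the autonomous system
   dX = b(X) dt + sigma(X) dW, whose solutions exist from every point of XX: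
   P(X_(s + t) \in B | X_s = x) = K t x B. The values K t x for x outside XX
   are irrelevant. *)
Definition transition_kernel (K : R -> R.-pker (Rn R n) ~> (Rn R n)) : Prop :=
  [/\ forall t x, 0 <= t -> XX x -> K t x XX = 1%E,
      forall x, XX x ->
        exists (d : measure_display) (Omega : measurableType d)
          (P : probability Omega R) (Fil : R -> set (set Omega))
          (W : R -> Omega -> 'rV[R]_q) (X : R -> Omega -> 'rV[R]_n),
          [/\ sde_solution P Fil W `[0, +oo[ (fun=> b) sigma X,
              {ae P, forall w, X 0 w = x} & stays_in P `[0, +oo[ XX X] &
      forall (d : measure_display) (Omega : measurableType d)
          (P : probability Omega R) (Fil : R -> set (set Omega))
          (W : R -> Omega -> 'rV[R]_q) (X : R -> Omega -> 'rV[R]_n),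
        sde_solution P Fil W `[0, +oo[ (fun=> b) sigma X ->
        stays_in P `[0, +oo[ XX X ->
        forall (s t : R) (A B : set (Rn R n)), 0 <= s -> 0 <= t ->
          measurable A -> measurable B ->
          P (X s @^-1` A `&` X (s + t) @^-1` B) =
          (\int[P]_(w in X s @^-1` A) K t (X s w) B)%E].

(* (K^t f)(x) = E[f(X_t) | X_0 = x] *)
Definition koopman (K : R -> R.-pker (Rn R n) ~> (Rn R n)) (t : R)
    (f : 'rV[R]_n -> R) (x : 'rV[R]_n) : R :=
  \int[K t x]_(y in XX) f y.

Definition invariant_measure (K : R -> R.-pker (Rn R n) ~> (Rn R n))
    (mu : probability (Rn R n) R) : Prop :=
  mu XX = 1%E /\
  forall f : Rn R n -> R, measurable_fun (XX : set (Rn R n)) f ->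
    (exists C : R, forall x, XX x -> `|f x| <= C) ->
    forall t, 0 <= t ->
      \int[mu]_(x in XX) koopman K t f x = \int[mu]_(x in XX) f x.

Definition exponentially_stable (K : R -> R.-pker (Rn R n) ~> (Rn R n))
    (mu : probability (Rn R n) R) (M omega : R) : Prop :=
  forall f, in_L2 mu f -> \int[mu]_(x in XX) f x = 0 ->
    forall t, 0 <= t ->
      (norm_L2 mu (koopman K t f) <=
         (M * expR (- (omega * t)))%:E * norm_L2 mu f)%E.

(* f is in the domain of the L^2_mu(XX) generator of K, which maps it to
   (the class of) g *)
Definition generator_L2 (K : R -> R.-pker (Rn R n) ~> (Rn R n))
    (mu : probability (Rn R n) R) (f g : 'rV[R]_n -> R) : Prop :=
  [/\ in_L2 mu f, in_L2 mu g &
      norm_L2 mu (fun x => (koopman K t f x - f x) / t - g x) @[t --> 0^'+]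
        --> 0%E].

Local Notation ev j := (delta_mx ord0 j : 'rV[R]_n).

(* b . grad f + 1/2 sigma sigma^T : Hess f *)
Definition diff_op (f : 'rV[R]_n -> R) (x : 'rV[R]_n) : R :=
  \sum_(j < n) b x ord0 j * 'D_(ev j) f x +
  2^-1 * \sum_(j < n) \sum_(k < n) (sigma x *m (sigma x)^T) j k *
           'D_(ev j) (fun y => 'D_(ev k) f y) x.

(* The partial derivatives with a nonzero coefficient in diff_op exist at x;
   in particular no second derivative is required when sigma x = 0. *)
Definition diff_op_defined (f : 'rV[R]_n -> R) (x : 'rV[R]_n) : Prop :=
  (forall j, b x ord0 j != 0 -> derivable f x (ev j)) /\
  (forall j k, (sigma x *m (sigma x)^T) j k != 0 ->
     (\forall y \near x, derivable f y (ev k)) /\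
     derivable (fun y => 'D_(ev k) f y) x (ev j)).

(* The differential operator on the functions that it maps into L^2_mu(XX);
   derivatives at boundary points of XX are those of the chosen extension. *)
Definition diff_op_L2 (mu : probability (Rn R n) R) (f g : 'rV[R]_n -> R) :
    Prop :=
  [/\ in_L2 mu f, in_L2 mu g &
      {ae mu, forall x, XX x -> diff_op_defined f x /\ g x = diff_op f x}].

End Generator.

(* Normalized n-dimensional Lebesgue measure on XX; lambda is determined by its
   values on boxes. *)
Definition normalized_lebesgue (R : realType) (n : nat) (XX : set 'rV[R]_n)
    (mu : probability (Rn R n) R) : Prop :=
  exists lambda : {measure set (Rn R n) -> \bar R},
    [/\ forall a c : 'rV[R]_n, (forall j, a ord0 j <= c ord0 j) ->
          lambda [set x | forall j, a ord0 j <= (x : 'rV[R]_n) ord0 j <= c ord0 j]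
          = (\prod_(j < n) (c ord0 j - a ord0 j))%:E,
        (0 < lambda XX)%E &
        forall A : set (Rn R n), measurable A ->
          mu A = (fine (lambda (A `&` XX)) / fine (lambda XX))%:E].

(* Ergodic dt M omega : sampling with time step dt along a trajectory, where
   |K^t| <= M exp(- omega t) on the mean-zero subspace of L^2 *)
Inductive sampling (R : realType) :=
  | IidLebesgue
  | IidInvariant
  | Ergodic of R & R & R.

Section Sampling.
Context {R : realType} {n q : nat}.
Variables (XX : set 'rV[R]_n) (b : 'rV[R]_n -> 'rV[R]_n)
  (sigma : 'rV[R]_n -> 'M[R]_(n, q)) (mu : probability (Rn R n) R)
  (K : R -> R.-pker (Rn R n) ~> (Rn R n)).

(* K plays no role in the case IidLebesgue, where XX need not be forward
   invariant. *)
Definition sampling_assumption (mode : sampling R) : Prop :=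
  match mode with
  | IidLebesgue => compact XX /\ normalized_lebesgue XX mu
  | IidInvariant => transition_kernel XX b sigma K /\ invariant_measure XX K mu
  | Ergodic dt M omega =>
      [/\ transition_kernel XX b sigma K,
          invariant_measure XX K mu /\
            (forall nu : probability (Rn R n) R, invariant_measure XX K nu ->
               forall A : set (Rn R n), measurable A -> nu A = mu A),
          0 < dt,
          1 <= M /\ 0 < omega &
          exponentially_stable XX K mu M omega]
  end.

Definition generator (mode : sampling R) (f g : 'rV[R]_n -> R) : Prop :=
  if mode is IidLebesgue then diff_op_L2 XX b sigma mu f g
  else generator_L2 XX K mu f g.

Definition is_sample (mode : sampling R) (d : measure_display)
    (Omega : measurableType d) (P : probability Omega R) (m : nat)
    (x : 'I_m -> Omega -> 'rV[R]_n) : Prop :=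
  (forall k w, XX (x k w)) /\
  match mode with
  | IidLebesgue | IidInvariant => iid P mu x
  | Ergodic dt _ _ =>
      exists (Fil : R -> set (set Omega)) (W : R -> Omega -> 'rV[R]_q)
        (X : R -> Omega -> 'rV[R]_n),
        [/\ sde_solution P Fil W `[0, +oo[ (fun=> b) sigma X,
            stays_in P `[0, +oo[ XX X,
            has_law P (X 0) mu &
            forall k w, x k w = X (k%:R * dt) w]
  end.

End Sampling.

Section EDMD.
Context {R : realType} {n N : nat}.

Definition galerkin_C (XX : set 'rV[R]_n) (mu : probability (Rn R n) R)
    (psi : 'I_N -> 'rV[R]_n -> R) : 'M[R]_N :=
  \matrix_(j, k) inner_L2 XX mu (psi j) (psi k).

Definition galerkin_A (XX : set 'rV[R]_n) (mu : probability (Rn R n) R)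
    (psi Lpsi : 'I_N -> 'rV[R]_n -> R) : 'M[R]_N :=
  \matrix_(j, k) inner_L2 XX mu (psi j) (Lpsi k).

Definition galerkin_L (XX : set 'rV[R]_n) (mu : probability (Rn R n) R)
    (psi Lpsi : 'I_N -> 'rV[R]_n -> R) : 'M[R]_N :=
  invmx (galerkin_C XX mu psi) *m galerkin_A XX mu psi Lpsi.

Definition stack (psi : 'I_N -> 'rV[R]_n -> R) (x : 'rV[R]_n) : 'cV[R]_N :=
  \col_j psi j x.

Definition empirical_C (psi : 'I_N -> 'rV[R]_n -> R) (m : nat)
    (x : 'I_m -> 'rV[R]_n) : 'M[R]_N :=
  m%:R^-1 *: \sum_(k < m) stack psi (x k) *m (stack psi (x k))^T.

Definition empirical_A (psi Lpsi : 'I_N -> 'rV[R]_n -> R) (m : nat)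
    (x : 'I_m -> 'rV[R]_n) : 'M[R]_N :=
  m%:R^-1 *: \sum_(k < m) stack psi (x k) *m (stack Lpsi (x k))^T.

Definition empirical_L (psi Lpsi : 'I_N -> 'rV[R]_n -> R) (m : nat)
    (x : 'I_m -> 'rV[R]_n) : 'M[R]_N :=
  invmx (empirical_C psi x) *m empirical_A psi Lpsi x.

End EDMD.

Definition control_affine (R : realType) (N nc : nat)
    (L : 'I_nc.+1 -> 'M[R]_N) (u : 'rV[R]_nc) : 'M[R]_N :=
  L ord0 + \sum_(i < nc) u ord0 i *: (L (lift ord0 i) - L ord0).

(* Caratheodory solution on [0, T] of z' = A(t) z, z(0) = z0, for A bounded and
   measurable *)
Definition linear_ode_solution (R : realType) (N : nat) (T : R)
    (A : R -> 'M[R]_N) (z0 : 'cV[R]_N) (z : R -> 'cV[R]_N) : Prop :=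
  {within `[0, T], continuous z} /\
  forall t, 0 <= t <= T -> forall j,
    z t j ord0 =
      z0 j ord0 + \int[lebesgue_measure]_(s in `[0, t]) (A s *m z s) j ord0.

(* Main.v *)
Require Import Defs.
From mathcomp Require Import all_boot all_order all_algebra.
From mathcomp Require Import all_classical all_reals all_analysis.
From mathcomp Require Import measurable_realfun ess_sup_inf.
From mathcomp Require Import ring lra.

Set Implicit Arguments.
Unset Strict Implicit.
Unset Printing Implicit Defensive.

Import Order.TTheory GRing.Theory Num.Theory.
Import numFieldNormedType.Exports.

Local Open Scope classical_set_scope.
Local Open Scope ring_scope.

(* The entries of the empirical matrices C~ and A~ converge in probability to
   those of C and A, uniformly over all probability spaces carrying a sample.
   Only the integrability of the products psi_j psi_k and psi_j (L psi_k) is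
   available, so the weak law is shown in L^1 form: by second moments for
   indicator functions, where independence or the exponential decay of the
   Koopman semigroup bounds the covariances, then for simple functions, then by
   their density in L^1(mu). The Gram matrix C of the free functions psi_j is
   invertible, (C, A) |-> C^-1 A is stable under small perturbations, and so
   is, by Gronwall's lemma, the solution of the linear equation. The same
   stability at the random pair (C~, A~) shows that the event is relatively
   closed in terms of finitely many measurable functions, hence measurable. *)

(** * Perturbation of C^-1 A *)

(** The products psi_j (L psi_k) may have infinite variance, so Chebyshev's inequality does not
    apply to them directly. What allows the passage to an L^1 limit is that the mean of |h - g| over
    samples of law mu has expectation equal to the integral of |h - g|, whatever the dependence
    between the samples. The rank m0 precedes the probability space, so every constant that fixes it
    comes from the measures mu_i, the decay rates and the control alone. The solutions z~ are an
    arbitrary family indexed by the outcome, constrained only where all C~ are invertible; nothing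
    is known about their measurability, which is why the event needs an argument of its own. The
    good event controls all matrix entries at once and does not involve t: the stability estimates
    are uniform in time, and a single use of Markov's inequality, for the sum of all deviations,
    gives its probability. *)

Section EntrywiseNorm.
Context {R : realFieldType}.

(** This norm is submultiplicative and dominates each entry, so entrywise bounds turn into norm
    bounds and back at the price of the number of entries only. *)
Definition mxnorm1 (m n : nat) (X : 'M[R]_(m, n)) : R :=
  \sum_j \sum_k `|X j k|.

Lemma mxnorm1_ge0 m n (X : 'M[R]_(m, n)) : 0 <= mxnorm1 X.
Proof. by apply: sumr_ge0 => j _; apply: sumr_ge0. Qed.

Lemma ler_entry_mxnorm1 m n (X : 'M[R]_(m, n)) j k : `|X j k| <= mxnorm1 X.
Proof.
rewrite /mxnorm1 (bigD1 j) //= (bigD1 k) //= -addrA lerDl addr_ge0 //.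
  by apply: sumr_ge0.
by apply: sumr_ge0 => i _; apply: sumr_ge0.
Qed.

Lemma ler_mxnorm1D m n (X Y : 'M[R]_(m, n)) :
  mxnorm1 (X + Y) <= mxnorm1 X + mxnorm1 Y.
Proof.
rewrite -big_split; apply: ler_sum => j _; rewrite -big_split.
by apply: ler_sum => k _; rewrite mxE ler_normD.
Qed.

Lemma mxnorm1N m n (X : 'M[R]_(m, n)) : mxnorm1 (- X) = mxnorm1 X.
Proof.
by apply: eq_bigr => j _; apply: eq_bigr => k _; rewrite mxE normrN.
Qed.

Lemma mxnorm1_eq0 m n (X : 'M[R]_(m, n)) : mxnorm1 X <= 0 -> X = 0.
Proof.
move=> X0; apply/matrixP => j k; rewrite mxE; apply/normr0_eq0.
by apply/eqP; rewrite eq_le normr_ge0 (le_trans (ler_entry_mxnorm1 _ _ _)).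
Qed.

Lemma ler_mxnorm1M m n p (X : 'M[R]_(m, n)) (Y : 'M[R]_(n, p)) :
  mxnorm1 (X *m Y) <= mxnorm1 X * mxnorm1 Y.
Proof.
rewrite /mxnorm1 big_distrl; apply: ler_sum => j _ /=.
rewrite big_distrl /=.
apply: (@le_trans _ _ (\sum_k \sum_l `|X j l| * `|Y l k|)).
  apply: ler_sum => k _; rewrite mxE (le_trans (ler_norm_sum _ _ _)) //.
  by apply: ler_sum => l _; rewrite normrM.
rewrite exchange_big /=; apply: ler_sum => l _.
rewrite -mulr_sumr ler_wpM2l //.
rewrite [leRHS](bigD1 l) //= lerDl.
by apply: sumr_ge0 => i _; apply: sumr_ge0.
Qed.

Lemma mxnorm1_le m n (X : 'M[R]_(m, n)) e :
  (forall j k, `|X j k| <= e) -> mxnorm1 X <= e * (m * n)%:R.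
Proof.
move=> Xe; apply: (@le_trans _ _ (\sum_(j < m) \sum_(k < n) e)).
  by apply: ler_sum => j _; apply: ler_sum => k _.
by rewrite !sumr_const !card_ord -mulrnA mulr_natr mulnC.
Qed.

(* C' (C'^-1 A' - C^-1 A) = (A' - A) - (C' - C) C^-1 A *)
Lemma invmx_mul_stable N (C A : 'M[R]_N) (rho : R) :
  C \in unitmx -> 0 < rho ->
  exists2 eta : R, 0 < eta & forall C' A' : 'M[R]_N,
    (forall j k, `|C' j k - C j k| <= eta) ->
    (forall j k, `|A' j k - A j k| <= eta) ->
    C' \in unitmx /\
    forall j k, `|(invmx C' *m A') j k - (invmx C *m A) j k| <= rho.
Proof.
move=> uC rho0.
pose kap := mxnorm1 (invmx C); pose L := invmx C *m A.
pose n2 : R := (N * N)%:R.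
(* [D] collects the factors of two estimates: eta * D <= 1 yields kap |C' - C| <= 1/2, which makes
   C' invertible, and eta * D <= rho yields the final bound. The added 1s keep [D] positive when kap
   or N vanishes. *)
pose D : R := 2 * (kap + 1) * (n2 + 1) * (1 + mxnorm1 L).
have kap0 : 0 <= kap by exact: mxnorm1_ge0.
have L0 : 0 <= mxnorm1 L by exact: mxnorm1_ge0.
have n0 : 0 <= n2 by [].
have D0 : 0 < D by rewrite !mulr_gt0 //; lra.
pose eta := Num.min 1 rho / D.
have min0 : 0 < Num.min 1 rho by rewrite lt_min ltr01.
have eta0 : 0 < eta by rewrite divr_gt0.
have etaE : eta * D = Num.min 1 rho by rewrite divfK // gt_eqF.
have min1 : Num.min 1 rho <= 1 by rewrite ge_min lexx.
have minr : Num.min 1 rho <= rho by rewrite ge_min lexx orbT.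
exists eta => // C' A' CC' AA'.
have nE : mxnorm1 (C' - C) <= eta * n2.
  by apply: mxnorm1_le => j k; rewrite !mxE.
have nA : mxnorm1 (A' - A) <= eta * n2.
  by apply: mxnorm1_le => j k; rewrite !mxE.
have DE : eta * D = 2 * (kap * (eta * n2) + kap * eta + eta * n2 + eta)
   * (1 + mxnorm1 L) by rewrite /D; ring.
have p1 : 0 <= kap * (eta * n2).
  exact: mulr_ge0 kap0 (mulr_ge0 (ltW eta0) n0).
have p2 : 0 <= kap * eta by exact: mulr_ge0 kap0 (ltW eta0).
have p3 : 0 <= eta * n2 by exact: mulr_ge0 (ltW eta0) n0.
have bnd : 2 * (kap * (eta * n2)) * (1 + mxnorm1 L) <= Num.min 1 rho.
  by rewrite -etaE DE ler_wpM2r; lra.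
have kE : 2 * (kap * mxnorm1 (C' - C)) <= 1.
  apply: le_trans min1; apply: le_trans bnd.
  have := ler_wpM2l kap0 nE; have := mulr_ge0 p1 L0; lra.
(* X = C^-1 C' X - C^-1 (C' - C) X *)
have inj p (X : 'M[R]_(N, p)) : mxnorm1 X <= 2 * kap * mxnorm1 (C' *m X).
  have := ler_mxnorm1D (invmx C *m (C' *m X)) (- (invmx C *m ((C' - C) *m X))).
  have -> : invmx C *m (C' *m X) - invmx C *m ((C' - C) *m X) = X.
    by rewrite -mulmxBr -mulmxBl opprB addrC subrK mulmxA mulVmx // mul1mx.
  rewrite mxnorm1N => h.
  have h1 := ler_mxnorm1M (invmx C) (C' *m X).
  have h2 := ler_mxnorm1M (invmx C) ((C' - C) *m X).
  have h3 := ler_wpM2l kap0 (ler_mxnorm1M (C' - C) X).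
  have h4 := ler_wpM2r (mxnorm1_ge0 X) kE.
  rewrite -/kap in h1 h2; lra.
have uC' : C' \in unitmx.
  (* C' annihilates the columns of its cokernel matrix, which must vanish by [inj]. *)
  rewrite -row_full_unit -cokermx_eq0; apply/eqP/mxnorm1_eq0.
  have := inj _ (cokermx C'); rewrite mulmx_coker.
  suff -> : mxnorm1 (0 : 'M[R]_N) = 0 by rewrite mulr0.
  rewrite /mxnorm1 big1 // => j _; rewrite big1 // => k _.
  by rewrite mxE normr0.
split=> // j k.
have -> : (invmx C' *m A') j k - (invmx C *m A) j k = (invmx C' *m A' - L) j k.
  by rewrite !mxE.
apply: le_trans (ler_entry_mxnorm1 _ _ _) _.
apply: le_trans (inj _ _) _.
have -> : C' *m (invmx C' *m A' - L) = (A' - A) - (C' - C) *m L.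
  rewrite mulmxBr mulmxA mulmxV // mul1mx mulmxBl [C *m L]mulmxA mulmxV //.
  by rewrite mul1mx opprB addrA subrK.
have h1 := ler_mxnorm1D (A' - A) (- ((C' - C) *m L)).
rewrite mxnorm1N in h1.
have h2 := ler_mxnorm1M (C' - C) L.
have h3 := ler_wpM2r L0 nE.
have h : mxnorm1 (A' - A - (C' - C) *m L) <= eta * n2 * (1 + mxnorm1 L).
  by lra.
have := ler_wpM2l kap0 h; lra.
Qed.

End EntrywiseNorm.

(** * Linear Caratheodory equations *)

(** An essentially bounded control dominates only almost everywhere. Integrability of f is a
    conclusion, inherited from g. *)
Lemma le_normr_Rintegral_ae d (T : measurableType d) (R : realType)
    (mu : {measure set T -> \bar R}) (D : set T) (f g : T -> R) :
  measurable D -> measurable_fun D f -> mu.-integrable D (EFin \o g) ->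
  (forall x, D x -> 0 <= g x) ->
  {ae mu, forall x, D x -> `|f x| <= g x} ->
  mu.-integrable D (EFin \o f) /\
  `|\int[mu]_(x in D) f x| <= \int[mu]_(x in D) g x.
Proof.
move=> mD mf ig g0 fg.
have mg : measurable_fun D g.
  by apply/measurable_EFinP; exact: (measurable_int mu).
have le_fg : (\int[mu]_(x in D) `|(f x)%:E| <= \int[mu]_(x in D) (g x)%:E)%E.
  apply: ae_ge0_le_integral => //.
  - by do 2 apply: measurableT_comp => //; exact/measurable_EFinP.
  - exact/measurable_EFinP.
have fin_g : (\int[mu]_(x in D) (g x)%:E)%E \is a fin_num.
  exact: integrable_fin_num.
have intf : mu.-integrable D (EFin \o f).
  apply/integrableP; split; first exact/measurable_EFinP.
  by apply: le_lt_trans le_fg _; rewrite ltey_eq fin_g.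
split=> //; rewrite -lee_fin EFin_normr_Rintegral // /Rintegral fineK //.
apply: le_trans le_fg; apply: le_abse_integral => //.
exact/measurable_EFinP.
Qed.

Section Gronwall.
Context {R : realType}.
Local Notation leb := (@lebesgue_measure R).

Lemma integrable_continuous_itv (T t : R) (f : R -> R) : t <= T ->
  {within `[0, T], continuous f} -> leb.-integrable `[0, t] (EFin \o f).
Proof.
move=> tT cf; apply: continuous_compact_integrable.
  exact: segment_compact.
by apply: continuous_subspaceW cf; apply: subset_itvl; rewrite bnd_simp.
Qed.

Lemma continuous_expRM (l : R) : continuous (fun s : R => expR (l * s)).
Proof.
move=> s; apply: continuous_comp; last exact: continuous_expR.
exact: mulrl_continuous.
Qed.

Lemma Rintegral_expRM (l t : R) : 0 < l -> 0 <= t ->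
  \int[leb]_(s in `[0, t]) expR (l * s) <= expR (l * t) / l.
Proof.
move=> l0; rewrite le_eqVlt => /predU1P[<-|t0].
  by rewrite set_itv1 Rintegral_set1 divr_ge0 ?expR_ge0 // ltW.
pose F s := expR (l * s) / l.
have dF (s : R^o) : is_derive s 1 (F : R^o -> R^o) (expR (l * s)).
  apply: is_derive_eq.
  by rewrite /GRing.scale /=; field; rewrite gt_eqF.
rewrite /Rintegral (@continuous_FTC2 _ _ F) //.
- by rewrite -EFinB /= lerBlDr lerDl divr_ge0 ?expR_ge0 // ltW.
- exact/continuous_subspaceT/continuous_expRM.
- have cF : continuous F.
    by move=> s; apply/differentiable_continuous/derivable1_diffP/ex_derive.
  by split; [move=> s _; apply/ex_derive|exact/cvg_at_right_filter/cF|
     exact/cvg_at_left_filter/cF].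
- by move=> s _; rewrite derive1E; apply: derive_val.
Qed.

(* The supremum S of phi t * exp (- l t), for l = 2 b + 1, satisfies
   S <= c + S / 2. *)
Lemma gronwall (T c b : R) (phi : R -> R) :
  0 <= T -> 0 <= c -> 0 <= b ->
  {within `[0, T], continuous phi} ->
  (forall t, 0 <= t <= T -> 
     phi t <= c + b * \int[leb]_(s in `[0, t]) phi s) ->
  forall t, 0 <= t <= T -> phi t <= 2 * c * expR ((2 * b + 1) * T).
Proof.
move=> T0 c0 b0 cphi hphi t tT.
(* The factor 2 makes b / l at most 1/2; the 1 keeps l positive when b = 0. *)
pose l := 2 * b + 1; have l0 : 0 < l by rewrite /l; lra.
have cpsi : {within `[0, T], continuous (fun s => phi s * expR (- l * s))}.
  move=> s; apply: cvgM; first exact: cphi.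
  by apply: continuous_subspaceT => {}s; exact: continuous_expRM.
have [t1 t1T maxS] := EVT_max T0 cpsi.
set S := phi t1 * _ in maxS.
have eK s : expR (- l * s) * expR (l * s) = 1.
  by rewrite -expRD mulNr addNr expR0.
have leS s : 0 <= s <= T -> phi s <= S * expR (l * s).
  move=> sT; rewrite -[leLHS]mulr1 -(eK s) mulrA ler_wpM2r ?expR_ge0 //.
  by apply: maxS; rewrite in_itv.
have eT : expR (l * t) <= expR (l * T).
  by rewrite ler_expR ler_pM2l //; case/andP: tT.
have S2 : S <= 2 * c.
  have [S0|/ltW S0] := leP S 0; first lra.
  rewrite in_itv /= in t1T; have /andP[t10 t1T'] := t1T.
  have h : \int[leb]_(s in `[0, t1]) phi s <= S * (expR (l * t1) / l).
    apply: (@le_trans _ _ (\int[leb]_(s in `[0, t1]) (S * expR (l * s)))).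
      apply: le_Rintegral => //.
      - exact: integrable_continuous_itv cphi.
      - apply: (@integrable_continuous_itv T) => //.
        apply: continuous_subspaceT => s; apply: cvgM; first exact: cvg_cst.
        exact: continuous_expRM.
      - move=> s /=; rewrite in_itv /= => /andP[s0 st1].
        by apply: leS; rewrite s0 (le_trans st1).
    rewrite RintegralZl //.
      by rewrite ler_wpM2l // Rintegral_expRM.
    apply: (@integrable_continuous_itv T) => //.
    exact/continuous_subspaceT/continuous_expRM.
  have h1 := le_trans (hphi _ t1T) (lerD (lexx c) (ler_wpM2l b0 h)).
  have : S <= (c + b * (S * (expR (l * t1) / l))) * expR (- l * t1).
    by rewrite /S ler_wpM2r ?expR_ge0.
  have -> : (c + b * (S * (expR (l * t1) / l))) * expR (- l * t1) =
      c * expR (- l * t1) + b / l * S * (expR (- l * t1) * expR (l * t1)).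
    by field; rewrite gt_eqF.
  rewrite eK mulr1.
  have e1 : c * expR (- l * t1) <= c.
    by rewrite ler_piMr // -expR0 ler_expR mulNr oppr_le0 mulr_ge0 // ltW.
  have bl : b / l <= 2^-1 by rewrite ler_pdivrMr // /l; lra.
  have := ler_wpM2r S0 bl; lra.
apply: le_trans (leS t tT) _.
have := ler_wpM2r (expR_ge0 (l * t)) S2.
have c20 : 0 <= 2 * c by lra.
have := ler_wpM2l c20 eT; rewrite -/l; lra.
Qed.

(** Each of the N components is bounded through the whole l^1 norm, so that norm satisfies the
    scalar inequality with coefficient N b; the forcing r adds at most r T per component. The lemma
    serves twice: with r = 0 for the size of a solution, with v = 0 for the difference of two. *)
Lemma vector_gronwall (N : nat) (T b r : R) (v : 'I_N -> R)
    (y : R -> 'I_N -> R) (f : R -> 'I_N -> R) :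
  0 <= T -> 0 <= b -> 0 <= r ->
  (forall j, {within `[0, T], continuous (y ^~ j)}) ->
  (forall j, measurable_fun `[0, T] (f ^~ j)) ->
  {ae leb, forall s, `[0, T]%classic s -> 
     forall j, `|f s j| <= b * \sum_k `|y s k| + r} ->
  (forall t, 0 <= t <= T -> forall j,
     y t j = v j + \int[leb]_(s in `[0, t]) f s j) ->
  forall t, 0 <= t <= T ->
  \sum_j `|y t j| <=
    2 * (\sum_j `|v j| + N%:R * (r * T)) * expR ((2 * (N%:R * b) + 1) * T).
Proof.
move=> T0 b0 r0 cy mf fb yE.
have cphi : {within `[0, T], continuous (fun s => \sum_k `|y s k|)}.
  move=> s; apply: cvg_big => [|k _]; first exact: add_continuous.
  by apply: cvg_norm; exact: cy.
apply: gronwall => //.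
- by rewrite addr_ge0 ?mulr_ge0 // sumr_ge0.
- by rewrite mulr_ge0.
move=> t tT; have /andP[t0 t_T] := tT.
have sub : `[0, t] `<=` `[0, T] by apply: subset_itvl; rewrite bnd_simp.
have iphi := integrable_continuous_itv t_T cphi.
have ir : leb.-integrable `[0, t] (EFin \o cst r).
  apply: (@integrable_continuous_itv T) => //.
  by apply: continuous_subspaceT => s; exact: cvg_cst.
have ibphi : leb.-integrable `[0, t] (EFin \o (fun s => b * \sum_k `|y s k|)).
  apply: (@integrable_continuous_itv T) => // s.
  by apply: cvgM; [exact: cvg_cst|exact: cphi].
have ig : leb.-integrable `[0, t] (EFin \o (fun s => b * \sum_k `|y s k| + r)).
  apply: (@integrable_continuous_itv T) => // s.
  apply: cvgD; last exact: cvg_cst.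
  by apply: cvgM; [exact: cvg_cst|exact: cphi].
have le_int j : `|y t j| <=
    `|v j| + (b * \int[leb]_(s in `[0, t]) (\sum_k `|y s k|) + r * T).
  rewrite yE // (le_trans (ler_normD _ _)) // lerD2l.
  have [] := @le_normr_Rintegral_ae _ _ R leb `[0, t]%classic
    (f ^~ j) (fun s => b * \sum_k `|y s k| + r).
  - by [].
  - exact: measurable_funS (mf j).
  - exact: ig.
  - by move=> s _; rewrite addr_ge0 // mulr_ge0 // sumr_ge0.
  - have aeF := ae_filter_ringOfSetsType leb.
    by apply: (filterS _ fb) => s h /sub st; exact: h.
  move=> _ /le_trans -> //.
  rewrite RintegralD // RintegralZl // lerD2l Rintegral_cst // ler_wpM2l //.
  have h : leb `[0, t] = t%:E.
    rewrite [LHS](lebesgue_measure_itv `[0, t]%R) /= lte_fin.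
    case: ltP => [_|t00]; first by rewrite -EFinB subr0.
    by have -> : t = 0 by apply/eqP; rewrite eq_le t0 t00.
  by apply: (@le_trans _ _ (fine t%:E)) => //; rewrite -h; exact: lexx.
apply: (le_trans (ler_sum _ (fun j _ => le_int j))).
rewrite big_split /= sumr_const card_ord -[_ *+ N]mulr_natl.
lra.
Qed.

End Gronwall.

Section LinearODE.
Context {R : realType}.
Local Notation leb := (@lebesgue_measure R).

Lemma norm2_le (N : nat) (v : 'cV[R]_N) (e : R) : 0 <= e ->
  (norm2 v <= e) = (\sum_j v j ord0 ^+ 2 <= e ^+ 2).
Proof.
move=> e0; rewrite /norm2 -[e in LHS]ger0_norm // -sqrtr_sqr ler_sqrt //.
exact: sqr_ge0.
Qed.

Lemma norm2_le_sum (N : nat) (v : 'cV[R]_N) : norm2 v <= \sum_j `|v j ord0|.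
Proof.
have S0 : 0 <= \sum_j `|v j ord0| by apply: sumr_ge0.
rewrite norm2_le // expr2 mulr_suml; apply: ler_sum => j _.
rewrite -[v j ord0 ^+ 2]real_normK ?num_real // expr2.
by rewrite ler_wpM2l // (bigD1 j) //= lerDl sumr_ge0.
Qed.

(** The Euclidean ball is closed under l^1 approximation: for |x| <= e and |k| <= 1, the increment
    (x + k)^2 - x^2 = k (2 x + k) is at most |k| (2 e + 1), whence the constant [D]. *)
Lemma norm2_le_closed (N : nat) (v : 'cV[R]_N) (e : R) : 0 <= e ->
  (forall h, 0 < h -> exists2 u : 'cV[R]_N,
     norm2 u <= e & \sum_j `|v j ord0 - u j ord0| <= h) ->
  norm2 v <= e.
Proof.
move=> e0 H; rewrite norm2_le //; apply/ler_addgt0Pr => h h0.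
pose D := 2 * e + 1; have D0 : 0 < D by rewrite /D; lra.
pose g := Num.min 1 (h / D).
have g0 : 0 < g by rewrite lt_min ltr01 divr_gt0.
have g1 : g <= 1 by rewrite ge_min lexx.
have gD : g * D <= h by rewrite -ler_pdivlMr // ge_min lexx orbT.
have [u ue] := H g g0; rewrite norm2_le // in ue => uv.
have uj j : `|u j ord0| <= e.
  rewrite -(@ler_pXn2r _ 2) ?nnegrE // real_normK ?num_real //.
  apply: le_trans ue; rewrite (bigD1 j) //= lerDl sumr_ge0 // => ? _.
  exact: sqr_ge0.
have vuj j : `|v j ord0 - u j ord0| <= 1.
  apply: le_trans g1; apply: le_trans uv.
  by rewrite (bigD1 j) //= lerDl sumr_ge0.
have step j : v j ord0 ^+ 2 <= u j ord0 ^+ 2 + `|v j ord0 - u j ord0| * D.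
  have := uj j; have := vuj j.
  set x := u j ord0; set k := v j ord0 - x => k1 xe.
  have -> : v j ord0 ^+ 2 = x ^+ 2 + k * (2 * x + k) by rewrite /k; ring.
  rewrite lerD2l (le_trans (ler_norm _)) // normrM ler_wpM2l //.
  by apply: le_trans (ler_normD _ _) _; rewrite normrM ger0_norm // /D; lra.
apply: (le_trans (ler_sum _ (fun j _ => step j))).
rewrite big_split /= -mulr_suml lerD //.
by apply: le_trans gD; rewrite ler_wpM2r // ltW.
Qed.

(** One null set is common to all entries, as for coefficients that are affine in an essentially
    bounded control. *)
Definition coeff_bounded (T : R) (N : nat) (A : R -> 'M[R]_N) (b : R) : Prop :=
  (forall j k, measurable_fun `[0, T] (fun s => A s j k)) /\
  {ae leb, forall s, `[0, T]%classic s -> forall j k, `|A s j k| <= b}.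

Lemma mulmx_entry_le (N : nat) (A : 'M[R]_N) (z : 'cV[R]_N) (b : R) j :
  (forall k, `|A j k| <= b) ->
  `|(A *m z) j ord0| <= b * \sum_k `|z k ord0|.
Proof.
move=> Ab; rewrite mxE mulr_sumr (le_trans (ler_norm_sum _ _ _)) //.
by apply: ler_sum => k _; rewrite normrM ler_wpM2r.
Qed.

Lemma linear_ode_solution_continuous (N : nat) T (A : R -> 'M[R]_N) z0 z j :
  linear_ode_solution T A z0 z ->
  {within `[0, T], continuous (fun s => z s j ord0)}.
Proof.
move=> [cz _] s.
exact: (@continuous_comp (subspace `[0, T]) _ _ z
  (fun M : 'cV[R]_N => M j ord0) s (cz s) (@coord_continuous _ _ _ _ _ _)).
Qed.

Lemma measurable_linear_ode_rhs (N : nat) T (A : R -> 'M[R]_N) z0 z b j :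
  coeff_bounded T A b -> linear_ode_solution T A z0 z ->
  measurable_fun `[0, T] (fun s => (A s *m z s) j ord0).
Proof.
move=> [mA _] solz.
rewrite (_ : (fun s => _) = fun s => \sum_k A s j k * z s k ord0); last first.
  by apply/funext => s; rewrite mxE.
apply: measurable_sum => k; apply: measurable_funM; first exact: mA.
apply: subspace_continuous_measurable_fun => //.
exact: linear_ode_solution_continuous solz.
Qed.

Lemma linear_ode_bound (N : nat) T (A : R -> 'M[R]_N) z0 z b :
  0 <= T -> 0 <= b -> coeff_bounded T A b -> linear_ode_solution T A z0 z ->
  forall t, 0 <= t <= T ->
  \sum_j `|z t j ord0| <=
    2 * (\sum_j `|z0 j ord0|) * expR ((2 * (N%:R * b) + 1) * T).
Proof.
move=> T0 b0 cA solz t tT.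
have := @vector_gronwall R N T b 0 (fun j => z0 j ord0) (fun s j => z s j ord0)
  (fun s j => (A s *m z s) j ord0) T0 b0 (lexx 0).
rewrite mul0r mulr0 addr0; apply => //.
- by move=> j; exact: linear_ode_solution_continuous solz.
- by move=> j; exact: measurable_linear_ode_rhs cA solz.
- have aeF := ae_filter_ringOfSetsType leb.
  apply: (filterS _ cA.2) => s h sT j; rewrite addr0.
  by apply: mulmx_entry_le => k; exact: h.
- exact: solz.2.
Qed.

(** Allows the integral equations of two solutions to be subtracted. *)
Lemma integrable_linear_ode_rhs (N : nat) T (A : R -> 'M[R]_N) z0 z b t j :
  0 <= b -> 0 <= t <= T -> coeff_bounded T A b ->
  linear_ode_solution T A z0 z ->
  leb.-integrable `[0, t] (EFin \o (fun s => (A s *m z s) j ord0)).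
Proof.
move=> b0 /andP[t0 tT] cA solz.
have sub : `[0, t] `<=` `[0, T] by apply: subset_itvl; rewrite bnd_simp.
have aeF := ae_filter_ringOfSetsType leb.
have cz k : {within `[0, T], continuous (fun s => z s k ord0)}.
  exact: linear_ode_solution_continuous solz.
have cphi : {within `[0, T], continuous (fun s => b * \sum_k `|z s k ord0|)}.
  move=> s; apply: cvgM; first exact: cvg_cst.
  apply: cvg_big => [|k _]; first exact: add_continuous.
  by apply: cvg_norm; exact: cz.
have [] // := @le_normr_Rintegral_ae _ _ R leb `[0, t]%classic
  (fun s => (A s *m z s) j ord0) (fun s => b * \sum_k `|z s k ord0|).
- exact: measurable_funS (measurable_linear_ode_rhs j cA solz).
- exact: integrable_continuous_itv cphi.
- by move=> s _; rewrite mulr_ge0 // sumr_ge0.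
- apply: (filterS _ cA.2) => s h /sub sT.
  by apply: mulmx_entry_le => k; exact: h.
Qed.

(** The difference y = z' - z solves y' = A' y + (A' - A) z with y(0) = 0. The second term is a
    forcing of size r Z, where Z is the a priori bound of [linear_ode_bound] for z. *)
Lemma linear_ode_diff (N : nat) (T : R) (A A' : R -> 'M[R]_N) z0 z z'
    (b r : R) :
  0 <= T -> 0 <= b -> 0 <= r ->
  coeff_bounded T A b -> coeff_bounded T A' b ->
  {ae leb, forall s, `[0, T]%classic s ->
    forall j k, `|A' s j k - A s j k| <= r} ->
  linear_ode_solution T A z0 z -> linear_ode_solution T A' z0 z' ->
  let e := expR ((2 * (N%:R * b) + 1) * T) in
  forall t, 0 <= t <= T ->
  \sum_j `|z' t j ord0 - z t j ord0| <=
    r * (2 * (N%:R * (2 * (\sum_j `|z0 j ord0|) * e * T)) * e).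
Proof.
move=> T0 b0 r0 cA cA' AA' solz solz' e t tT.
set Z := 2 * (\sum_j `|z0 j ord0|) * e.
have Zb s : 0 <= s <= T -> \sum_j `|z s j ord0| <= Z.
  exact: linear_ode_bound T0 b0 cA solz s.
have Z0 : 0 <= Z by rewrite !mulr_ge0 ?expR_ge0 // sumr_ge0.
have := @vector_gronwall R N T b (r * Z) (fun=> 0)
  (fun s j => z' s j ord0 - z s j ord0)
  (fun s j => (A' s *m z' s) j ord0 - (A s *m z s) j ord0) T0 b0
  (mulr_ge0 r0 Z0).
rewrite [X in X + _]big1 => [|j _]; last by rewrite normr0.
rewrite add0r -/e => H.
suff -> : r * (2 * (N%:R * (Z * T)) * e) = 2 * (N%:R * (r * Z * T)) * e.
  apply: H => //.
  - move=> j s.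
    have cz : {within `[0, T], continuous (fun s => z s j ord0)}.
      exact: linear_ode_solution_continuous solz.
    have cz' : {within `[0, T], continuous (fun s => z' s j ord0)}.
      exact: linear_ode_solution_continuous solz'.
    by apply: cvgB; [exact: cz'|exact: cz].
  - move=> j; apply: measurable_funB;
      [exact: measurable_linear_ode_rhs cA' solz'|
       exact: measurable_linear_ode_rhs cA solz].
  - have aeF := ae_filter_ringOfSetsType leb.
    apply: (filterS2 _ _ cA'.2 AA') => s h1 h2 sT j.
    have -> : (A' s *m z' s) j ord0 - (A s *m z s) j ord0 =
        (A' s *m (z' s - z s)) j ord0 + ((A' s - A s) *m z s) j ord0.
      by rewrite mulmxBr mulmxBl !mxE; ring.
    rewrite (le_trans (ler_normD _ _)) //; apply: lerD.
      apply: le_trans (mulmx_entry_le _ (h1 sT j)) _.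
      rewrite le_eqVlt; apply/predU1P; left; congr (_ * _).
      by apply: eq_bigr => k _; rewrite !mxE.
    apply: (@le_trans _ _ (r * \sum_k `|z s k ord0|)).
      by apply: mulmx_entry_le => k; rewrite !mxE; exact: h2.
    by rewrite ler_wpM2l // Zb //; move: sT; rewrite /= in_itv.
  - move=> s sT j; rewrite add0r RintegralB //; last 2 first.
    + exact: integrable_linear_ode_rhs b0 sT cA' solz'.
    + exact: integrable_linear_ode_rhs b0 sT cA solz.
    by rewrite solz.2 // solz'.2 //; ring.
by ring.
Qed.

Lemma admissible_control_bounded (n nc q : nat) XX F G sigma T x0
    (u : R -> 'rV[R]_nc) :
  @admissible_control R n nc q XX F G sigma T x0 u ->
  (forall i, measurable_fun `[0, T] (fun s => u s ord0 i)) /\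
  exists2 a : R, 0 <= a &
    {ae leb, forall s, `[0, T]%classic s -> forall i, `|u s ord0 i| <= a}.
Proof.
move=> [uL _]; have aeF := ae_filter_ringOfSetsType leb.
split=> [i|].
  have := sub_Lfun_mfun (uL i); rewrite inE /= => h.
  by apply/(measurable_restrictT _ _).
have H i : exists a,
    {ae leb, forall s, `[0, T]%classic s -> `|u s ord0 i| <= a}.
  have := sub_Lfun_finLfun (uL i); rewrite inE /= /finite_norm unlock.
  (* The L^infinity norm is the essential supremum only if the whole space has positive measure. *)
  rewrite ifT; last first.
    rewrite -set_itvNyy [ltRHS](lebesgue_measure_itv `]-oo, +oo[%R) /=.
    exact: lt0y.
  set f := abse \o _; have := @ess_sup_ge _ _ _ leb f.
  (* A finite supremum is the bound sought, +oo contradicts the finite norm, and below -oo no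
     absolute value can lie, so that any constant works. *)
  move: (ess_sup leb f) => [a| |] //= h _.
    exists a; apply: (filterS _ h) => s fs sT; move: fs.
    by rewrite /f /= patchE mem_set // lee_fin.
  by exists 0; apply: (filterS _ h) => s; rewrite leeNy_eq.
have [a Ha] := choice H; exists (\sum_i `|a i|); first by rewrite sumr_ge0.
have : {ae leb, forall s, forall i, `[0, T]%classic s -> `|u s ord0 i| <= a i}.
  exact: filter_forall.
apply: filterS => s h sT i; apply: le_trans (h i sT) _.
by rewrite (le_trans (ler_norm _)) // (bigD1 i) //= lerDl sumr_ge0.
Qed.

(** The 1 accounts for L_0, and the 2 for each difference L_i - L_0. *)
Lemma control_affine_entry_le (N nc : nat) (L : 'I_nc.+1 -> 'M[R]_N)
    (u : 'rV[R]_nc) (a r : R) : 0 <= r ->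
  (forall i, `|u ord0 i| <= a) -> (forall i j k, `|L i j k| <= r) ->
  forall j k, `|control_affine L u j k| <= r * (1 + 2 * (nc%:R * a)).
Proof.
move=> r0 ua Lr j k; rewrite /control_affine mxE summxE.
rewrite (le_trans (ler_normD _ _)) // mulrDr mulr1 lerD //.
rewrite (le_trans (ler_norm_sum _ _ _)) //.
apply: (@le_trans _ _ (\sum_(i < nc) (2 * r * a))).
  apply: ler_sum => i _; rewrite !mxE normrM mulrC.
  have h : `|L (lift ord0 i) j k - L ord0 j k| <= 2 * r.
    by rewrite (le_trans (ler_normB _ _)) // mulr2n mulrDl mul1r lerD.
  exact: ler_pM.
by rewrite sumr_const card_ord -mulr_natl; lra.
Qed.

Lemma control_affineB (N nc : nat) (L L' : 'I_nc.+1 -> 'M[R]_N)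
    (u : 'rV[R]_nc) :
  control_affine L' u - control_affine L u =
  control_affine (fun i => L' i - L i) u.
Proof.
rewrite /control_affine opprD addrACA -sumrB; congr (_ + _).
apply: eq_bigr => i _; rewrite -scalerBr; congr (_ *: _).
by apply/matrixP => j k; rewrite !mxE; ring.
Qed.

(** Here rho depends on neither the solutions nor t. Capping it by 1 keeps every entry of L' below
    [Lam + 1], so the coefficient bound b, and with it the Gronwall constant, is fixed before rho is
    chosen. *)
Lemma linear_ode_stable (N nc : nat) (T : R) (alpha : R -> 'rV[R]_nc) (a : R)
    (L : 'I_nc.+1 -> 'M[R]_N) (z0 : 'cV[R]_N) (eps : R) :
  0 <= T -> 0 <= a -> 0 < eps ->
  (forall i, measurable_fun `[0, T] (fun s => alpha s ord0 i)) ->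
  {ae leb, forall s, `[0, T]%classic s -> forall i, `|alpha s ord0 i| <= a} ->
  exists2 rho, 0 < rho & forall L' : 'I_nc.+1 -> 'M[R]_N,
    (forall i j k, `|L' i j k - L i j k| <= rho) ->
    forall z z',
    linear_ode_solution T (fun t => control_affine L (alpha t)) z0 z ->
    linear_ode_solution T (fun t => control_affine L' (alpha t)) z0 z' ->
    forall t, 0 <= t <= T -> \sum_j `|z' t j ord0 - z t j ord0| <= eps.
Proof.
move=> T0 a0 eps0 ma ba.
have aeF := ae_filter_ringOfSetsType leb.
pose g := 1 + 2 * (nc%:R * a).
have g0 : 0 <= g by rewrite addr_ge0 // !mulr_ge0.
pose Lam := \sum_i mxnorm1 (L i).
have Lam0 : 0 <= Lam by apply: sumr_ge0 => i _; exact: mxnorm1_ge0.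
have LLam i j k : `|L i j k| <= Lam.
  rewrite (le_trans (ler_entry_mxnorm1 _ _ _)) // /Lam (bigD1 i) //= lerDl.
  by apply: sumr_ge0 => ? _; exact: mxnorm1_ge0.
pose b := (Lam + 1) * g.
have b0 : 0 <= b by rewrite mulr_ge0 // addr_ge0.
have cb (M : 'I_nc.+1 -> 'M[R]_N) : (forall i j k, `|M i j k| <= Lam + 1) ->
    coeff_bounded T (fun t => control_affine M (alpha t)) b.
  move=> Mb; split=> [j k|].
    rewrite (_ : (fun s => _) = fun s => M ord0 j k +
        \sum_(i < nc) alpha s ord0 i * (M (lift ord0 i) - M ord0) j k);
        last first.
      apply/funext => s; rewrite mxE summxE; congr (_ + _).
      by apply: eq_bigr => i _; rewrite mxE.
    apply: measurable_funD; first exact: measurable_cst.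
    apply: measurable_sum => i.
    by apply: measurable_funM; [exact: ma|exact: measurable_cst].
  apply: (filterS _ ba) => s h sT.
  by apply: control_affine_entry_le => //; [rewrite addr_ge0|exact: h].
pose e := expR ((2 * (N%:R * b) + 1) * T).
pose D := 2 * (N%:R * (2 * (\sum_j `|z0 j ord0|) * e * T)) * e.
have S0 : 0 <= \sum_j `|z0 j ord0| by apply: sumr_ge0.
have e0 : 0 <= e by exact: expR_ge0.
have D0 : 0 <= D by rewrite !mulr_ge0.
pose rho := Num.min 1 (eps / (g * D + 1)).
have gD0 : 0 < g * D + 1 by have := mulr_ge0 g0 D0; lra.
have rho0 : 0 < rho by rewrite lt_min ltr01 divr_gt0.
have rho1 : rho <= 1 by rewrite ge_min lexx.
have rhoD : rho * (g * D + 1) <= eps.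
  by rewrite -ler_pdivlMr // ge_min lexx orbT.
exists rho => // L' LL' z z' solz solz' t tT.
have cL : coeff_bounded T (fun t => control_affine L (alpha t)) b.
  by apply: cb => i j k; rewrite (le_trans (LLam i j k)) // lerDl.
have cL' : coeff_bounded T (fun t => control_affine L' (alpha t)) b.
  apply: cb => i j k; rewrite -(subrK (L i j k) (L' i j k)) addrC.
  by rewrite (le_trans (ler_normD _ _)) // lerD // (le_trans (LL' i j k)).
have AA' : {ae leb, forall s, `[0, T]%classic s -> forall j k,
    `|control_affine L' (alpha s) j k - control_affine L (alpha s) j k|
      <= rho * g}.
  apply: (filterS _ ba) => s h sT j k.
  have -> : control_affine L' (alpha s) j k - control_affine L (alpha s) j k =
    control_affine (fun i => L' i - L i) (alpha s) j k.
    by rewrite -control_affineB !mxE.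
  apply: control_affine_entry_le; [exact: ltW|exact: h|].
  by move=> i j' k'; rewrite !mxE.
have rg0 : 0 <= rho * g by rewrite mulr_ge0 // ltW.
apply: le_trans (linear_ode_diff T0 b0 rg0 cL cL' AA' solz solz' tT) _.
by rewrite -/e -/D; move: rhoD rho0; lra.
Qed.

End LinearODE.

(** * Measurability and stability of the reduced model *)

(* E is the intersection over k of the union of the sets {|f - c| < 1/k} that
   meet E, for c in the countable set of rational vectors. *)
Lemma measurable_of_approx (R : realType) d (Omega : measurableType d)
    (J : finType) (f : J -> Omega -> R) (D E : set Omega) :
  (forall j, measurable_fun setT (f j)) -> measurable D -> E `<=` D ->
  (forall w, D w ->
     (forall h, 0 < h -> exists2 w', E w' & forall j, `|f j w' - f j w| <= h) ->
     E w) ->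
  measurable E.
Proof.
move=> mf mD ED closed.
pose B (k : nat) (c : {ffun J -> rat}) : set Omega :=
  \bigcap_(j in [set: J]) [set w | `|f j w - ratr (c j)| < k.+1%:R^-1].
pose U k c := if `[< exists2 w', E w' & B k c w' >] then B k c else set0.
have mB k c : measurable (B k c).
  apply: fin_bigcap_measurable => // j _; rewrite -[X in measurable X]setTI.
  have : measurable_fun setT (fun w => `|f j w - ratr (c j)| < k.+1%:R^-1).
    apply: measurable_fun_ltr; last exact: measurable_cst.
    apply: measurableT_comp => //; apply: measurable_funB => //.
  by move=> /(_ measurableT [set true] I); congr measurable; apply/seteqP;
    split.
suff -> : E = D `&` \bigcap_k \bigcup_c U k c.
  apply: measurableI => //; apply: bigcapT_measurable => k.
  apply: countable_bigcupT_measurable => [|c]; first exact: countableP.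
  by rewrite /U; case: ifPn.
have inv0 k : 0 < k.+1%:R^-1 :> R by rewrite invr_gt0.
apply/seteqP; split=> [w Ew|w [Dw Hw]].
  split; first exact: ED.
  move=> k _.
  have H j : exists q : rat, `|f j w - ratr q| < k.+1%:R^-1.
    have h0 := inv0 k; set h := _^-1 in h0 *.
    have [|q] := @rat_in_itvoo R (f j w - h) (f j w + h); first by lra.
    by rewrite in_itv /= => qh; exists q; rewrite ltr_distlC.
  have [c Hc] := fin_all_exists H; exists [ffun j => c j] => //.
  have Bw : B k [ffun j => c j] w by move=> j _ /=; rewrite ffunE.
  by rewrite /U; case: asboolP => // -[]; exists w.
(* For every k, w shares a cell of radius 1/(k+1) with some point of E, hence is within 2/(k+1) of
   it in each coordinate. *)
apply: closed => // h h0.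
have [k kh] : exists k : nat, 2 * k.+1%:R^-1 <= h.
  exists (Num.truncn (2 / h)); rewrite ler_pdivrMr // mulrC -ler_pdivrMr //.
  exact/ltW/truncnS_gt.
have [c _] := Hw k I; rewrite /U; case: asboolP => // -[w' Ew' Bw'] Bw.
exists w' => // j; apply: le_trans kh.
have := Bw' j I; have := Bw j I => /=; set x := ratr _ => h1 h2.
rewrite (le_trans (ler_distD x _ _)) // [`|x - _|]distrC.
by rewrite mulr_natl mulr2n lerD // ltW.
Qed.

(** The centre (C, A) is arbitrary up to invertibility: it will be the exact pair for the
    probability estimate and the empirical pair of a fixed outcome for measurability. *)
Lemma edmd_stable (R : realType) (N nc : nat) (T : R)
    (alpha : R -> 'rV[R]_nc) (a : R) (C A : 'I_nc.+1 -> 'M[R]_N)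
    (z0 : 'cV[R]_N) (eps : R) :
  0 <= T -> 0 <= a -> 0 < eps ->
  (forall i, measurable_fun `[0, T] (fun s => alpha s ord0 i)) ->
  {ae lebesgue_measure, forall s, `[0, T]%classic s ->
    forall i, `|alpha s ord0 i| <= a} ->
  (forall i, C i \in unitmx) ->
  exists2 eta, 0 < eta & forall C' A' : 'I_nc.+1 -> 'M[R]_N,
    (forall i j k, `|C' i j k - C i j k| <= eta) ->
    (forall i j k, `|A' i j k - A i j k| <= eta) ->
    (forall i, C' i \in unitmx) /\
    forall z z',
    linear_ode_solution T
      (fun t => control_affine (fun i => invmx (C i) *m A i) (alpha t)) z0 z ->
    linear_ode_solution T
      (fun t => control_affine (fun i => invmx (C' i) *m A' i) (alpha t))
      z0 z' ->
    forall t, 0 <= t <= T -> \sum_j `|z' t j ord0 - z t j ord0| <= eps.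
Proof.
move=> T0 a0 eps0 ma ba uC.
have [rho rho0 Hrho] :=
  linear_ode_stable (fun i => invmx (C i) *m A i) z0 T0 a0 eps0 ma ba.
have /choice[eta Heta] i : exists e : R, 0 < e /\
    forall C' A' : 'M[R]_N, (forall j k, `|C' j k - C i j k| <= e) ->
    (forall j k, `|A' j k - A i j k| <= e) -> C' \in unitmx /\
    forall j k, `|(invmx C' *m A') j k - (invmx (C i) *m A i) j k| <= rho.
  by have [e e0 He] := invmx_mul_stable (A i) (uC i) rho0; exists e.
exists (\big[Order.min/1]_i eta i).
  by apply: lt_bigmin => // i _; have [] := Heta i.
move=> C' A' CC' AA'.
have le_eta i : \big[Order.min/1]_i eta i <= eta i by exact: bigmin_le.
have HL i : C' i \in unitmx /\
    forall j k, `|(invmx (C' i) *m A' i) j k - (invmx (C i) *m A i) j k| <= rho.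
  by apply: (Heta i).2 => j k; apply: le_trans (le_eta i).
split=> [i|]; first exact: (HL i).1.
by apply: Hrho => i; exact: (HL i).2.
Qed.

(** * Weak law of large numbers *)

Lemma integral_probability_cst (R : realType) d (T : measurableType d)
    (P : probability T R) (r : R) : (\int[P]_x r%:E = r%:E)%E.
Proof. by rewrite integral_cst // [X in (_ * X)%E]probability_setT mule1. Qed.

Section LawOfLargeNumbers.
Context {R : realType} {n : nat}.
Variable mu : probability (Rn R n) R.

(** The restriction to D is what the joint law of a trajectory at two times requires. *)
Lemma integral_has_law_in d (Omega : measurableType d)
    (P : probability Omega R) (Y : Omega -> 'rV[R]_n) (D : set (Rn R n))
    (f : Rn R n -> \bar R) : has_law P Y mu -> measurable D ->
  measurable_fun setT f -> (forall x, 0 <= f x)%E ->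
  (\int[P]_(w in Y @^-1` D) f (Y w) = \int[mu]_(x in D) f x)%E.
Proof.
move=> [mY lawY] mD mf f0.
have := @ge0_integral_pushforward _ _ _ _ R (Y : Omega -> Rn R n) mY P D f
  mD (measurable_funTS mf) (fun x _ => f0 x).
move=> <-.
by apply: eq_measure_integral => A mA _; exact: lawY.
Qed.

Lemma integral_has_law d (Omega : measurableType d) (P : probability Omega R)
    (Y : Omega -> 'rV[R]_n) (f : Rn R n -> \bar R) :
  has_law P Y mu -> measurable_fun setT f -> (forall x, 0 <= f x)%E ->
  (\int[P]_w f (Y w) = \int[mu]_x f x)%E.
Proof. by move=> lawY mf f0; rewrite -(integral_has_law_in lawY). Qed.

(* Quantifying over the probability space makes the rank m0 in L1_lln
   independent of it. *)
Definition sampler := forall m d (Omega : measurableType d)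
  (P : probability Omega R), ('I_m -> Omega -> 'rV[R]_n) -> Prop.

Definition identically_distributed (S : sampler) : Prop :=
  forall m d (Omega : measurableType d) (P : probability Omega R)
    (x : 'I_m -> Omega -> 'rV[R]_n),
  S m d Omega P x -> forall k, has_law P (x k) mu.

(** For samples of law mu the double sum is the variance of the number of samples in A. It may grow
    at most linearly in m, with a factor c that may depend on A but not on the probability space. *)
Definition weakly_correlated (S : sampler) : Prop :=
  forall A : set (Rn R n), measurable A -> exists2 c : R, 0 <= c &
  forall m d (Omega : measurableType d) (P : probability Omega R)
    (x : 'I_m -> Omega -> 'rV[R]_n),
  S m d Omega P x ->
  \sum_k \sum_l (fine (P (x k @^-1` A `&` x l @^-1` A)) - fine (mu A) ^+ 2)
    <= c * m%:R.

(** Convergence in mean, unlike a variance bound, survives L^1 approximation of h; Markov's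
    inequality turns it into convergence in probability at the end. *)
Definition L1_lln (S : sampler) (h : Rn R n -> R) : Prop :=
  mu.-integrable setT (EFin \o h) /\
  forall eta : R, 0 < eta -> exists m0 : nat,
  forall m, (m0 <= m)%N -> forall d (Omega : measurableType d)
    (P : probability Omega R) (x : 'I_m -> Omega -> 'rV[R]_n),
  S m d Omega P x ->
  (\int[P]_w `|m%:R^-1 * \sum_k h (x k w) - \int[mu]_y h y|%:E <= eta%:E)%E.

Variable S : sampler.
Hypothesis S_law : identically_distributed S.

Section Sample.
Context (m : nat) d (Omega : measurableType d) (P : probability Omega R)
  (x : 'I_m -> Omega -> 'rV[R]_n) (Sx : S P x).

Lemma measurable_comp_sample (h : Rn R n -> R) k :
  measurable_fun setT h -> measurable_fun setT (fun w => h (x k w)).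
Proof. by move=> mh; apply: (measurableT_comp mh); exact: (S_law Sx k).1. Qed.

Lemma measurable_mean_dev (h : Rn R n -> R) (a : R) :
  measurable_fun setT h ->
  measurable_fun setT (fun w => `|m%:R^-1 * \sum_k h (x k w) - a|%:E).
Proof.
move=> mh; apply/measurable_EFinP/measurableT_comp => //.
apply: measurable_funB; last exact: measurable_cst.
apply: measurable_funM; first exact: measurable_cst.
by apply: measurable_sum => k; exact: measurable_comp_sample.
Qed.

End Sample.

Lemma L1_lln_measurable h : L1_lln S h -> measurable_fun setT h.
Proof. by case=> ih _; apply/measurable_EFinP; exact: (measurable_int mu). Qed.

(** With Y the number of samples in A, the expectation of |Y/m - p| is at most Var(Y) / (2 eta m^2)
    + eta / 2. As Var(Y) <= c m, the first term is at most eta / 2 once m >= c / eta^2, which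
    dictates the rank. *)
Lemma L1_lln_indic (A : set (Rn R n)) : weakly_correlated S ->
  measurable A -> L1_lln S \1_A.
Proof.
move=> Scor mA; split=> [|eta eta0].
  exact: integrable_indic.
have [c c0 Hc] := Scor _ mA.
exists (Num.truncn (c / eta ^+ 2)).+1 => m hm d Omega P x Sx.
set p := fine (mu A) in Hc.
have m0 : 0 < m%:R :> R by rewrite ltr0n (leq_trans _ hm).
have pE : mu A = p%:E by rewrite fineK // fin_num_measure.
have intA : \int[mu]_y \1_A y = p.
  by rewrite /Rintegral integral_indic // setIT.
rewrite intA.
have mAk k : measurable (x k @^-1` A).
  by rewrite -[X in measurable X]setTI; exact: (S_law Sx k).1.
pose Y w := \sum_k (\1_A (x k w) : R).
have mY : measurable_fun setT Y.
  by apply: measurable_sum => k; apply: (measurable_comp_sample Sx).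
(* Expanding (Y - m p)^2 with all terms moved to where they are nonnegative. *)
have YE w : ((Y w - m%:R * p) ^+ 2 + 2 * (m%:R * p) * Y w =
    \sum_k \sum_l (\1_(x k @^-1` A `&` x l @^-1` A) w : R) + (m%:R * p) ^+ 2).
  have -> : \sum_k \sum_l (\1_(x k @^-1` A `&` x l @^-1` A) w : R) = Y w ^+ 2.
    rewrite expr2 {1}/Y mulr_suml; apply: eq_bigr => k _.
    by rewrite mulr_sumr; apply: eq_bigr => l _; rewrite indicI.
  by ring.
have p0 : 0 <= p by rewrite fine_ge0.
have mp0 : 0 <= m%:R * p by rewrite mulr_ge0.
have Y0 w : 0 <= Y w by apply: sumr_ge0.
have intY : (\int[P]_w (Y w)%:E = (m%:R * p)%:E)%E.
  under eq_integral do rewrite -sumEFin.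
  rewrite ge0_integral_sum //; last first.
    by move=> k; apply/measurable_EFinP/(measurable_comp_sample Sx).
  rewrite (eq_bigr (fun=> p%:E)) => [|k _].
    by rewrite sumEFin sumr_const card_ord mulr_natl.
  rewrite (@integral_has_law _ _ _ _ (EFin \o \1_A) (S_law Sx k)) //.
  - by rewrite integral_indic // setIT.
  - exact/measurable_EFinP.
  - by move=> y; rewrite lee_fin.
pose V := (\int[P]_w ((Y w - m%:R * p) ^+ 2)%:E)%E.
have mV : measurable_fun setT (fun w => (Y w - m%:R * p) ^+ 2).
  by apply: measurable_funX; apply: measurable_funB.
have VE : (V + (2 * (m%:R * p) ^+ 2)%:E =
    (\sum_k \sum_l fine (P (x k @^-1` A `&` x l @^-1` A)) +
      (m%:R * p) ^+ 2)%:E)%E.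
  have -> : (2 * (m%:R * p) ^+ 2)%:E = (\int[P]_w (2 * (m%:R * p) * Y w)%:E)%E.
    under eq_integral do rewrite EFinM.
    rewrite ge0_integralZl_EFin //; last 3 first.
      + by move=> w _; rewrite lee_fin.
      + exact/measurable_EFinP.
      + by rewrite mulr_ge0.
    by rewrite intY -EFinM; congr (_%:E); ring.
  rewrite /V -ge0_integralD //; last 4 first.
  - by move=> w _; rewrite lee_fin sqr_ge0.
  - exact/measurable_EFinP.
  - by move=> w _; rewrite lee_fin !mulr_ge0.
  - by apply/measurable_EFinP/measurable_funM.
  under eq_integral do rewrite -EFinD YE EFinD.
  rewrite ge0_integralD //; last 3 first.
  - by move=> w _; rewrite lee_fin; do 2 apply: sumr_ge0 => ? _.
  - apply/measurable_EFinP; do 2 apply: measurable_sum => ?.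
    by apply: measurable_indic; exact: measurableI.
  - by move=> w _; rewrite lee_fin sqr_ge0.
  rewrite integral_probability_cst EFinD; congr (_ + _)%E.
  under eq_integral do rewrite -sumEFin.
  rewrite ge0_integral_sum //; last 2 first.
  - move=> k; apply/measurable_EFinP; apply: measurable_sum => l.
    by apply: measurable_indic; exact: measurableI.
  - by move=> k w _; rewrite lee_fin; apply: sumr_ge0 => ? _.
  rewrite -sumEFin; apply: eq_bigr => k _.
  under eq_integral do rewrite -sumEFin.
  rewrite ge0_integral_sum //; last first.
  - move=> l; apply/measurable_EFinP.
    by apply: measurable_indic; exact: measurableI.
  rewrite -sumEFin; apply: eq_bigr => l _.
  rewrite integral_indic //; last exact: measurableI.
  by rewrite setIT fineK // fin_num_measure //; exact: measurableI.
have Vc : (V <= (c * m%:R)%:E)%E.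
  have /(congr1 (fun y => y - (2 * (m%:R * p) ^+ 2)%:E)%E) := VE.
  rewrite addeK // => ->; rewrite -EFinB lee_fin.
  apply: le_trans (Hc _ _ _ _ _ Sx).
  under [leRHS]eq_bigr do rewrite sumrB sumr_const card_ord.
  rewrite sumrB sumr_const card_ord -mulrnA -[_ *+ (m * m)]mulr_natr natrM.
  by lra.
(* 2 |y| eta <= y^2 + eta^2 *)
have amgm w : `|m%:R^-1 * Y w - p| <=
    (2 * eta * m%:R ^+ 2)^-1 * (Y w - m%:R * p) ^+ 2 + eta / 2.
  have -> : m%:R^-1 * Y w - p = (Y w - m%:R * p) / m%:R.
    by field; rewrite gt_eqF.
  set y := (Y w - m%:R * p) / m%:R.
  have -> : Y w - m%:R * p = y * m%:R by rewrite /y divfK ?gt_eqF.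
  have -> : (2 * eta * m%:R ^+ 2)^-1 * (y * m%:R) ^+ 2 + eta / 2 =
    (`|y| ^+ 2 + eta ^+ 2) / (2 * eta).
    by rewrite real_normK ?num_real //; field; rewrite !gt_eqF.
  rewrite ler_pdivlMr ?mulr_gt0 //.
  have := sqr_ge0 (`|y| - eta); lra.
apply: (@le_trans _ _ (\int[P]_w
  (((2 * eta * m%:R ^+ 2)^-1)%:E * ((Y w - m%:R * p) ^+ 2)%:E +
   (eta / 2)%:E))%E).
  apply: ge0_le_integral => //.
  - by apply: (measurable_mean_dev Sx); exact: measurable_indic.
  - apply: emeasurable_funD => //; apply: emeasurable_funM => //.
    exact/measurable_EFinP.
  - by move=> w _; rewrite -EFinM -EFinD lee_fin amgm.
have k0 : 0 <= (2 * eta * m%:R ^+ 2)^-1 by rewrite invr_ge0 !mulr_ge0 // ltW.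
have e20 : 0 <= eta / 2 by rewrite divr_ge0 // ltW.
rewrite ge0_integralD //; last 2 first.
- by move=> w _; rewrite -EFinM lee_fin mulr_ge0 // sqr_ge0.
- by apply: emeasurable_funM => //; exact/measurable_EFinP.
rewrite integral_probability_cst.
rewrite ge0_integralZl_EFin //; last 2 first.
- by move=> w _; rewrite lee_fin sqr_ge0.
- exact/measurable_EFinP.
rewrite -/V.
apply: (@le_trans _ _
  (((2 * eta * m%:R ^+ 2)^-1)%:E * (c * m%:R)%:E + (eta / 2)%:E)%E).
  by rewrite leeD2r // lee_wpmul2l // lee_fin.
rewrite -EFinM -EFinD lee_fin.
have cm : c <= eta ^+ 2 * m%:R.
  rewrite mulrC -ler_pdivrMr ?exprn_gt0 //.
  by apply: le_trans (ltW (truncnS_gt _)) _; rewrite ler_nat.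
have -> : (2 * eta * m%:R ^+ 2)^-1 * (c * m%:R) = c / (2 * eta * m%:R).
  by field; rewrite !gt_eqF.
have : c / (2 * eta * m%:R) <= eta / 2.
  rewrite ler_pdivrMr ?mulr_gt0 //.
  by have -> : eta / 2 * (2 * eta * m%:R) = eta ^+ 2 * m%:R by field.
by lra.
Qed.

End LawOfLargeNumbers.

(** * From indicators to integrable functions *)

Section L1LawClosure.
Import HBSimple.
Context {R : realType} {n : nat}.
Variables (mu : probability (Rn R n) R) (S : @sampler R n).
Hypothesis S_law : identically_distributed mu S.
Local Notation L1_lln := (@L1_lln R n mu S).

Lemma L1_llnD h1 h2 : L1_lln h1 -> L1_lln h2 ->
  L1_lln (fun y => h1 y + h2 y).
Proof.
move=> l1 l2; have [i1 H1] := l1; have [i2 H2] := l2.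
have mh1 := L1_lln_measurable l1; have mh2 := L1_lln_measurable l2.
split=> [|eta eta0]; first by have := integrableD measurableT i1 i2.
have e2 : 0 < eta / 2 by rewrite divr_gt0.
have [m1 {}H1] := H1 _ e2; have [m2 {}H2] := H2 _ e2.
exists (maxn m1 m2) => m; rewrite geq_max => /andP[/H1{}H1 /H2{}H2].
move=> d Omega P x Sx.
rewrite RintegralD // [eta]splitr EFinD.
apply: le_trans (leeD (H1 _ _ _ _ Sx) (H2 _ _ _ _ Sx)).
rewrite -ge0_integralD //; [|exact: (measurable_mean_dev S_law Sx) ..].
apply: ge0_le_integral => //.
- exact: (measurable_mean_dev S_law Sx _ (measurable_funD mh1 mh2)).
- by apply: emeasurable_funD; exact: (measurable_mean_dev S_law Sx).
- move=> w _; rewrite -EFinD lee_fin.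
  by rewrite big_split mulrDr /= opprD addrACA ler_normD.
Qed.

Lemma L1_llnZ (a : R) h : L1_lln h -> L1_lln (fun y => a * h y).
Proof.
move=> l; have [i H] := l; have mh := L1_lln_measurable l.
split=> [|eta eta0]; first by have := integrableZl measurableT a i.
(* The 1 keeps the divisor positive when a = 0. *)
have a1 : 0 < `|a| + 1 by rewrite ltr_wpDl.
have [m0 {}H] := H _ (divr_gt0 eta0 a1).
exists m0 => m mm0 d Omega P x Sx.
rewrite RintegralZl //.
apply: (@le_trans _ _ (\int[P]_w
    (`|a|%:E * `|m%:R^-1 * \sum_k h (x k w) - \int[mu]_y h y|%:E))%E).
  apply: ge0_le_integral => //.
  - apply: (@measurable_mean_dev _ _ _ _ S_law _ _ _ _ _ Sx (fun y => a * h y)).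
    exact: measurable_funM.
  - apply: emeasurable_funM; first exact: measurable_cst.
    exact: (measurable_mean_dev S_law Sx).
  - by move=> w _; rewrite -EFinM lee_fin -mulr_sumr mulrCA -mulrBr normrM.
rewrite ge0_integralZl_EFin //; last exact: (measurable_mean_dev S_law Sx).
apply: (@le_trans _ _ (`|a|%:E * (eta / (`|a| + 1))%:E)%E).
  by rewrite lee_wpmul2l // ?lee_fin // H.
rewrite -EFinM lee_fin mulrCA ler_piMr ?(ltW eta0) //.
by rewrite ler_pdivrMr // mul1r lerDl.
Qed.

Lemma L1_lln0 : L1_lln (fun=> 0).
Proof.
split=> [|eta eta0]; first exact: integrable0.
exists 0%N => m _ d Omega P x Sx.
rewrite big1 // mulr0 /Rintegral integral0 subr0 normr0 integral0 lee_fin.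
exact: ltW.
Qed.

Lemma L1_lln_sum (I : eqType) (s : seq I) (h : I -> Rn R n -> R) :
  (forall i, i \in s -> L1_lln (h i)) -> L1_lln (fun y => \sum_(i <- s) h i y).
Proof.
elim: s => [_|i s IH H].
  under eq_fun do rewrite big_nil; exact: L1_lln0.
under eq_fun do rewrite big_cons; apply: L1_llnD; first exact/H/mem_head.
by apply: IH => j js; apply: H; rewrite in_cons js orbT.
Qed.

Lemma L1_lln_sfun (g : {sfun Rn R n >-> R}) :
  weakly_correlated mu S -> L1_lln g.
Proof.
move=> Scor.
rewrite (_ : (g : Rn R n -> R) = fun y =>
    \sum_(r <- finmap.enum_fset (fset_set (range g)))
      r * \1_(g @^-1` [set r]) y).
  by apply: L1_lln_sum => r _; apply: L1_llnZ; apply: L1_lln_indic.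
by apply/funext => y; rewrite fimfunE fsbig_finite.
Qed.

(** Three thirds of eta: replacing h by a simple g costs the integral of |h - g| in the sample mean,
    by identical distribution, and at most as much in the exact mean; the law for g gives the last
    third. *)
Lemma L1_lln_integrable (h : Rn R n -> R) : weakly_correlated mu S ->
  mu.-integrable setT (EFin \o h) -> L1_lln h.
Proof.
move=> Scor ih; split=> // eta eta0.
have e3 : 0 < eta / 3 by rewrite divr_gt0.
have mh : measurable_fun setT h.
  by apply/measurable_EFinP; exact: (measurable_int mu).
have [g_ [ig _ cvg_g]] := approximation_sfun_integrable measurableT ih.
have [g [{}ig hg]] : exists g : {sfun Rn R n >-> R}, 
    mu.-integrable setT (EFin \o g) /\
    (\int[mu]_y `|h y - g y|%:E <= (eta / 3)%:E)%E.
  have /fine_cvgP[fin_g /cvgrPdist_le /(_ _ e3) near_g] := cvg_g.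
  have [k _ Hk] := filterI fin_g near_g; exists (g_ k); split=> //.
  have [/= fk] := Hk k (leqnn k); rewrite sub0r normrN => le_k.
  rewrite -[leLHS]fineK // lee_fin; exact: le_trans (ler_norm _) le_k.
have fin_hg : (\int[mu]_y `|h y - g y|%:E)%E \is a fin_num.
  by rewrite ge0_fin_numE ?integral_ge0 // (le_lt_trans hg) // ltry.
have lg := L1_lln_sfun g Scor.
have mg := L1_lln_measurable lg.
have [_ /(_ _ e3) [m0 H]] := lg.
(* The successor ensures m > 0, needed to cancel m against its inverse. *)
exists m0.+1 => m mm0 d Omega P x Sx.
have m_gt0 : 0 < m%:R :> R by rewrite ltr0n (leq_trans _ mm0).
have ihg : mu.-integrable setT (EFin \o (fun y => h y - g y)).
  by have := integrableB measurableT ih ig.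
have mhg : measurable_fun setT (fun y => `|h y - g y|).
  by apply: measurableT_comp => //; exact: measurable_funB.
have int_hg : `|\int[mu]_y g y - \int[mu]_y h y| <= eta / 3.
  rewrite distrC -RintegralB //.
  apply: le_trans (le_normr_Rintegral measurableT ihg) _.
  by rewrite /Rintegral -lee_fin fineK.
have mdg := measurable_mean_dev S_law Sx (\int[mu]_y g y) mg.
have mx k : measurable_fun setT (fun w => `|h (x k w) - g (x k w)|).
  exact: (measurable_comp_sample S_law Sx k mhg).
have msum : measurable_fun setT
    (fun w => (m%:R^-1 * \sum_k `|h (x k w) - g (x k w)|)%:E).
  apply/measurable_EFinP/measurable_funM => //.
  by apply: measurable_sum.
apply: (@le_trans _ _ (\int[P]_w
   ((m%:R^-1 * \sum_k `|h (x k w) - g (x k w)|)%:E +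
    (`|m%:R^-1 * \sum_k g (x k w) - \int[mu]_y g y|%:E + (eta / 3)%:E)))%E).
  apply: ge0_le_integral => //.
  - exact: (measurable_mean_dev S_law Sx).
  - by apply: emeasurable_funD => //; exact: emeasurable_funD.
  move=> w _; rewrite -!EFinD lee_fin.
  set a := \int[mu]_y h y in int_hg *; set b := \int[mu]_y g y in int_hg *.
  have -> : m%:R^-1 * \sum_k h (x k w) - a =
     m%:R^-1 * \sum_k (h (x k w) - g (x k w)) +
     ((m%:R^-1 * \sum_k g (x k w) - b) + (b - a)).
    by rewrite sumrB; ring.
  apply: le_trans (ler_normD _ _) _; apply: lerD.
    rewrite normrM ger0_norm ?invr_ge0 ?ler0n //.
    by rewrite ler_wpM2l ?invr_ge0 ?ler0n // ler_norm_sum.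
  by apply: le_trans (ler_normD _ _) _; apply: lerD.
have e30 : 0 <= eta / 3 by exact: ltW.
rewrite ge0_integralD //; first last.
- exact: emeasurable_funD.
- by move=> w _; rewrite adde_ge0 // lee_fin.
- by move=> w _; rewrite lee_fin mulr_ge0 ?invr_ge0 ?ler0n // sumr_ge0.
rewrite ge0_integralD // integral_probability_cst.
have -> : eta%:E = ((eta / 3)%:E + ((eta / 3)%:E + (eta / 3)%:E))%E.
  by rewrite -!EFinD; congr (_%:E); field.
apply: leeD; last by apply: leeD => //; apply: H => //; exact: ltnW.
apply: le_trans hg.
under eq_integral do rewrite EFinM -sumEFin.
rewrite ge0_integralZl_EFin //; first last.
- by under eq_fun do rewrite sumEFin; apply/measurable_EFinP/measurable_sum.
- by move=> w _; rewrite sumEFin lee_fin sumr_ge0.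
rewrite ge0_integral_sum //; last by move=> k; exact/measurable_EFinP.
rewrite (eq_bigr (fun=> \int[mu]_y `|h y - g y|%:E)%E) => [|k _]; last first.
  rewrite (@integral_has_law _ _ mu _ _ P (x k) (fun y => `|h y - g y|%:E)) //.
  - exact: S_law Sx k.
  - exact/measurable_EFinP.
rewrite -(fineK fin_hg) sumEFin sumr_const card_ord -EFinM lee_fin.
by rewrite -(mulr_natl (fine _) m) mulKf ?gt_eqF.
Qed.

End L1LawClosure.

(** * Covariances of the samples *)

(** Multiplied by 1 - r, the sum is at most 1 - r^(m - k), by induction on m. Truncated subtraction
    makes this 0 <= 0 while the sum is empty. *)
Lemma sum_geometric_le (R : realFieldType) (r : R) (m k : nat) :
  0 <= r -> r < 1 ->
  \sum_(l < m | (k <= l)%N) r ^+ (l - k) <= (1 - r)^-1.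
Proof.
move=> r0 r1; have r1' : 0 < 1 - r by rewrite subr_gt0.
rewrite -[leRHS]mul1r ler_pdivlMr // mulrC.
apply: (@le_trans _ _ (1 - r ^+ (m - k))); last by rewrite gerBl exprn_ge0.
elim: m => [|m IH]; first by rewrite big_ord0 mulr0 sub0n expr0 subrr.
rewrite big_mkcond big_ord_recr -big_mkcond /=.
case: leqP => km; last first.
  rewrite addr0; apply: le_trans IH _.
  have := ltnW km; move: km; rewrite -subn_eq0 => /eqP ->.
  by rewrite -subn_eq0 => /eqP ->.
rewrite mulrDr subSn // exprS; set u := r ^+ _ in IH *; lra.
Qed.

(** By symmetry a k l <= c k l + c l k, where [c] is the geometric bound on the upper triangle and 0
    elsewhere; each of the two terms sums to at most M m / (1 - r). *)
Lemma sum_geometric_dist_le (R : realFieldType) (r M : R) (m : nat)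
    (a : 'I_m -> 'I_m -> R) : 0 <= r -> r < 1 -> 0 <= M ->
  (forall k l, a k l = a l k) ->
  (forall k l : 'I_m, (k <= l)%N -> a k l <= M * r ^+ (l - k)) ->
  \sum_k \sum_l a k l <= 2 * M * (1 - r)^-1 * m%:R.
Proof.
move=> r0 r1 M0 aC aM.
pose c (k l : 'I_m) : R := if (k <= l)%N then M * r ^+ (l - k) else 0.
have c0 k l : 0 <= c k l.
  by rewrite /c; case: ifP => // _; rewrite mulr_ge0 ?exprn_ge0.
have cle : \sum_k \sum_l c k l <= M * (1 - r)^-1 * m%:R.
  apply: (@le_trans _ _ (\sum_(k < m) (M * (1 - r)^-1))).
    apply: ler_sum => k _; rewrite -big_mkcond /= -mulr_sumr ler_wpM2l //.
    exact: sum_geometric_le.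
  by rewrite sumr_const card_ord mulr_natr.
apply: (@le_trans _ _ (\sum_k \sum_l (c k l + c l k))).
  apply: ler_sum => k _; apply: ler_sum => l _.
  have [kl|lk] := leqP k l.
    by apply: (@le_trans _ _ (c k l)); rewrite ?lerDl // /c kl aM.
  apply: (@le_trans _ _ (c l k)); rewrite ?lerDr // /c (ltnW lk) aC aM //.
  exact: ltnW.
under eq_bigr do rewrite big_split.
rewrite big_split /= [X in _ + X]exchange_big /=; lra.
Qed.

(** Independence is given as a product rule over all m samples jointly; inserting the whole space at
    the other indices leaves the pair. *)
Lemma iid_pair (R : realType) (n m : nat) d (Omega : measurableType d)
    (P : probability Omega R) (mu : probability (Rn R n) R)
    (x : 'I_m -> Omega -> 'rV[R]_n) (A : set (Rn R n)) k l :
  measurable A -> iid P mu x -> k != l ->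
  P (x k @^-1` A `&` x l @^-1` A) = (mu A * mu A)%E.
Proof.
move=> mA [law indep] kl.
pose B (j : 'I_m) : set (Rn R n) := if (j == k) || (j == l) then A else setT.
have mB j : measurable (B j) by rewrite /B; case: ifP.
have := indep B mB.
rewrite (bigD1 k) //= (bigD1 l) /=; last by rewrite eq_sym.
rewrite big1 ?mule1 => [|j /andP[/negbTE jk /negbTE jl]]; last first.
  by rewrite /B jk jl preimage_setT probability_setT.
rewrite /B !eqxx orbT /= !(law _).2 // => <-; congr (P _).
apply/seteqP; split=> [w [Ak Al] j|w /= H].
  by rewrite /B; case: ifP => // /orP[]/eqP ->.
by split; [have := H k|have := H l]; rewrite /B eqxx ?orbT.
Qed.

(** * Invariant measures and transition kernels *)

Section Stationarity.
Context {R : realType} {n q : nat}.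
Variables (XX : set 'rV[R]_n) (b : 'rV[R]_n -> 'rV[R]_n)
  (sigma : 'rV[R]_n -> 'M[R]_(n, q)) (mu : probability (Rn R n) R)
  (K : R -> R.-pker (Rn R n) ~> (Rn R n)).
Hypotheses (mXX : measurable (XX : set (Rn R n)))
  (tK : transition_kernel XX b sigma K) (inv_mu : invariant_measure XX K mu).

Lemma measure_full_setI (Q : {measure set (Rn R n) -> \bar R})
    (A : set (Rn R n)) :
  Q setT = 1%E -> Q XX = 1%E -> measurable A -> Q (A `&` XX) = Q A.
Proof.
move=> QT QX mA; have QC : Q (~` XX) = 0%E.
  have : Q setT = (Q (~` XX) + Q XX)%E.
    by have := measureDI Q measurableT mXX; rewrite setTD setTI.
  rewrite QT QX; case: (Q (~` XX)) => [r| |] //.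
  by rewrite -EFinD => -[] r1; congr (_%:E); lra.
rewrite (measureDI Q mA mXX) [X in (X + _)%E](_ : _ = 0%E) ?add0e //.
by apply: (subset_measure0 _ _ _ QC) => [||y []] //; 
  [exact: measurableD|exact: measurableC].
Qed.

Lemma ge0_integral_full (f : Rn R n -> \bar R) :
  measurable_fun setT f -> (forall x, 0 <= f x)%E ->
  (\int[mu]_x f x = \int[mu]_(x in XX) f x)%E.
Proof.
move=> mf f0.
rewrite (@ge0_negligible_integral _ _ _ mu setT (~` XX)) //.
- by rewrite setTD setCK.
- exact: measurableC.
- by apply: etrans (probability_setC _ mXX) _; rewrite inv_mu.1 subee.
Qed.

Lemma transition_in t x (A : set (Rn R n)) : 0 <= t -> XX x ->
  measurable A -> K t x (A `&` XX) = K t x A.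
Proof.
move=> t0 Xx mA; have [KXX _ _] := tK.
by apply: measure_full_setI => //; [exact: prob_kernel|exact: KXX].
Qed.

Lemma measurable_transition t (A : set (Rn R n)) : measurable A ->
  measurable_fun setT (fun x => fine (K t x A)).
Proof.
move=> mA; apply: measurableT_comp => //.
exact: measurable_kernel.
Qed.

Lemma koopman_indicB t x (A : set (Rn R n)) (p : R) : 0 <= t -> XX x ->
  measurable A -> koopman XX K t (fun y => \1_A y - p) x = fine (K t x A) - p.
Proof.
move=> t0 Xx mA; have [KXX _ _] := tK.
have Kfin : (K t x XX < +oo)%E by rewrite KXX // ltry.
have i1 : (K t x).-integrable XX (EFin \o (\1_A : Rn R n -> R)).
  apply: measurable_bounded_integrable => //.
  exists 1; split=> // M M1 y _ /=; apply: le_trans (ltW M1).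
  by rewrite indicE; case: (_ \in _); rewrite /= ?normr1 ?normr0.
have i2 : (K t x).-integrable XX (EFin \o (fun=> p)).
  apply: measurable_bounded_integrable => //.
  by exists `|p|; split=> // M M1 y _ /=; apply: ltW.
rewrite /koopman RintegralB // Rintegral_cst //.
rewrite [X in p * fine X](KXX t x t0 Xx) mulr1; congr (_ - _).
by rewrite /Rintegral integral_indic // [in LHS](transition_in t0 Xx mA).
Qed.

Lemma koopman_indic t x (A : set (Rn R n)) : 0 <= t -> XX x ->
  measurable A -> koopman XX K t \1_A x = fine (K t x A).
Proof.
move=> t0 Xx mA.
by rewrite /koopman /Rintegral integral_indic // transition_in.
Qed.

End Stationarity.

Section ProbabilityLnorm.
Context {R : realType} d (T : measurableType d) (Q : probability T R).

Lemma Lnorm2_le1 (g : T -> R) : measurable_fun setT g ->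
  (forall x, `|g x| <= 1) -> ('N[Q]_2%:E[EFin \o g] <= 1)%E.
Proof.
move=> mg g1; rewrite unlock -(poweR1r (2^-1)).
have le1 : (\int[Q]_x `|(EFin \o g) x| `^ 2 <= 1)%E.
  rewrite -[leRHS](integral_probability_cst Q 1).
  apply: ge0_le_integral => //.
  - by move=> x _; exact: poweR_ge0.
  - rewrite (_ : (fun x => _) = EFin \o (fun x => powR `|g x| 2)) //.
    apply/measurable_EFinP.
    apply: (@measurableT_comp _ _ _ _ _ _ (@powR R ^~ 2)) => //.
    exact: measurableT_comp.
  - move=> x _; rewrite /= lee_fin.
    apply: (@le_trans _ _ (powR 1 2)); last by rewrite powR1.
    by rewrite ge0_ler_powR ?nnegrE.
apply: gt0_ler_poweR => //.
- by rewrite in_itv /= leey andbT integral_ge0 // => x _; exact: poweR_ge0.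
- by rewrite in_itv /= leey lee01.
Qed.

(** Cauchy-Schwarz against the constant 1, which has norm 1 under a probability. *)
Lemma Lnorm1_le_Lnorm2 (g : T -> R) : measurable_fun setT g ->
  (\int[Q]_x `|g x|%:E <= 'N[Q]_2%:E[EFin \o g])%E.
Proof.
move=> mg.
have := @hoelder _ _ _ Q g (cst 1) 2 2 mg (measurable_cst _).
rewrite Lnorm1 Lnorm_cst1 [X in (X `^ _)%E](probability_setT Q) poweR1r mule1.
under eq_integral do rewrite /= mulr1.
by apply => //; field.
Qed.

End ProbabilityLnorm.

Section Mixing.
Context {R : realType} {n q : nat}.
Variables (XX : set 'rV[R]_n) (b : 'rV[R]_n -> 'rV[R]_n)
  (sigma : 'rV[R]_n -> 'M[R]_(n, q)) (mu : probability (Rn R n) R)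
  (K : R -> R.-pker (Rn R n) ~> (Rn R n)).
Hypotheses (mXX : measurable (XX : set (Rn R n)))
  (tK : transition_kernel XX b sigma K) (inv_mu : invariant_measure XX K mu).

Lemma transition_fin t x (A : set (Rn R n)) : measurable A ->
  (fine (K t x A))%:E = K t x A /\ 0 <= fine (K t x A) <= 1.
Proof.
move=> mA; have K1 : (K t x A <= 1)%E.
  by rewrite -(prob_kernel (s := K t) x) le_measure ?inE.
have Kfin : K t x A \is a fin_num.
  by rewrite ge0_fin_numE // (le_lt_trans K1) // ltry.
by rewrite fineK // fine_ge0 //= -lee_fin fineK.
Qed.

(** Invariance tested on 1_B. It is stated with real-valued integrals, so finiteness of both sides
    must be supplied before the equality can be lifted to extended reals. *)
Lemma invariant_law t (B : set (Rn R n)) : 0 <= t -> measurable B ->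
  (\int[mu]_x K t x B = mu B)%E.
Proof.
move=> t0 mB; rewrite (ge0_integral_full mXX inv_mu) //; last first.
  exact: measurable_kernel.
have mB1 : measurable_fun (XX : set (Rn R n)) (\1_B : Rn R n -> R).
  exact: measurable_indic.
have bnd : exists C : R, forall x, XX x -> `|(\1_B : Rn R n -> R) x| <= C.
  by exists 1 => x _; rewrite indicE; case: (_ \in _); rewrite ?normr1 ?normr0.
have [muXX /(_ _ mB1 bnd _ t0)] := inv_mu.
have -> : \int[mu]_(x in XX) (\1_B x : R) = fine (mu B).
  rewrite /Rintegral integral_indic //.
  congr fine; apply: measure_full_setI => //; exact: probability_setT.
have -> : \int[mu]_(x in XX) koopman XX K t \1_B x =
    \int[mu]_(x in XX) fine (K t x B).
  by apply: eq_Rintegral => x /set_mem Xx; exact: (koopman_indic mXX tK).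
have KE : (\int[mu]_(x in XX) (fine (K t x B))%:E =
    \int[mu]_(x in XX) K t x B)%E.
  by apply: eq_integral => x _; exact: (transition_fin _ _ mB).1.
rewrite /Rintegral KE => H.
rewrite -[RHS]fineK ?fin_num_measure // -H fineK //.
rewrite ge0_fin_numE ?integral_ge0 //.
apply: (@le_lt_trans _ _ (\int[mu]_(x in XX) 1)%E).
  apply: ge0_le_integral => //; first exact/measurable_funTS/measurable_kernel.
  move=> x _; have [<- /andP[_]] := transition_fin t x mB; by rewrite lee_fin.
by rewrite integral_cst // mul1e [ltLHS]muXX ltry.
Qed.

Section Trajectory.
Context d (Omega : measurableType d) (P : probability Omega R)
  (Fil : R -> set (set Omega)) (W : R -> Omega -> 'rV[R]_q)
  (X : R -> Omega -> 'rV[R]_n).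
Hypotheses (solX : sde_solution P Fil W `[0, +oo[ (fun=> b) sigma X)
  (inX : stays_in P `[0, +oo[ XX X).

Lemma solution_measurable t : 0 <= t ->
  measurable_fun setT (X t : Omega -> Rn R n).
Proof.
move=> t0; have [[[_ FilS _] _] mX _ _ _] := solX.
move=> _ B mB; rewrite setTI; apply: (FilS t t0).
by apply: mX => //; rewrite /= in_itv /= andbT.
Qed.

Hypothesis law0 : has_law P (X 0) mu.

(** The Markov property from time 0, with no restriction on X_0, followed by invariance. *)
Lemma solution_has_law t : 0 <= t -> has_law P (X t) mu.
Proof.
move=> t0; split=> [|B mB]; first exact: solution_measurable.
have [_ _ H] := tK.
have := H _ _ _ _ _ _ solX inX 0 t setT B (lexx 0) t0 measurableT mB.
rewrite add0r preimage_setT setTI => ->.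
rewrite (integral_has_law (f := fun x => K t x B) law0) //.
  exact: invariant_law.
exact: measurable_kernel.
Qed.

Lemma solution_pair s t (A B : set (Rn R n)) : 0 <= s -> 0 <= t ->
  measurable A -> measurable B ->
  P (X s @^-1` A `&` X (s + t) @^-1` B) = (\int[mu]_(x in A) K t x B)%E.
Proof.
move=> s0 t0 mA mB; have [_ _ H] := tK.
rewrite (H _ _ _ _ _ _ solX inX) //.
apply: (integral_has_law_in (f := fun x => K t x B) (solution_has_law s0));
  rewrite //.
exact: measurable_kernel.
Qed.

(* The covariance is the integral over A of K^t (1_A - p), where p = mu A, and
   1_A - p has mean zero and L^2 norm at most 1. *)
Lemma solution_correlation M omega s t (A : set (Rn R n)) :
  exponentially_stable XX K mu M omega -> 0 <= M ->
  0 <= s -> 0 <= t -> measurable A ->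
  fine (P (X s @^-1` A `&` X (s + t) @^-1` A)) - fine (mu A) ^+ 2 <=
    M * expR (- (omega * t)).
Proof.
move=> stable M0 s0 t0 mA; rewrite solution_pair //.
set p := fine (mu A).
have pE : mu A = p%:E by rewrite fineK // fin_num_measure.
have p01 : 0 <= p <= 1.
  by rewrite fine_ge0 //= -lee_fin -pE probability_le1.
pose f (y : Rn R n) : R := \1_A y - p.
have mf : measurable_fun setT f by apply: measurable_funB.
have mfX : measurable_fun setT (f \_ (XX : set (Rn R n))).
  by apply: (measurable_restrictT f mXX).1; exact: measurable_funTS.
have f1 x : `|(f \_ (XX : set (Rn R n))) x| <= 1.
  rewrite patchE; case: ifP => _; last by rewrite normr0.
  rewrite /f indicE; case: (_ \in _) => /=; rewrite ler_norml; lra.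
have norm_f : (norm_L2 XX mu f <= 1)%E by exact: Lnorm2_le1.
have L2f : in_L2 XX mu f.
  rewrite /in_L2 inE; apply/andP; split; first by rewrite inE.
  rewrite inE; apply: le_lt_trans norm_f _; exact: ltry.
have mean_f : \int[mu]_(x in XX) f x = 0.
  have muXX := inv_mu.1.
  rewrite RintegralB //; last 2 first.
  - exact: (integrableS measurableT mXX _ (integrable_indic _ mA)).
  - exact: finite_measure_integrable_cst.
  rewrite Rintegral_cst // [X in p * fine X]muXX mulr1.
  rewrite /Rintegral integral_indic //.
  apply/eqP; rewrite subr_eq0; apply/eqP; congr fine.
  by apply: measure_full_setI => //; exact: probability_setT.
pose k x := fine (K t x A) - p.
have mk : measurable_fun setT k.
  by apply: measurable_funB => //; exact: measurable_transition.
have mkX : measurable_fun setT (k \_ (XX : set (Rn R n))).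
  by apply: (measurable_restrictT k mXX).1; exact: measurable_funTS.
(* On XX, k is K^t f, whose L^2 norm decays by exponential stability; the L^1 norm lies below it. *)
have le_k : (\int[mu]_(x in XX) `|k x|%:E <= (M * expR (- (omega * t)))%:E)%E.
  have := stable f L2f mean_f t t0.
  have Me0 : 0 <= M * expR (- (omega * t)) by rewrite mulr_ge0 ?expR_ge0.
  have -> : norm_L2 XX mu (koopman XX K t f) = norm_L2 XX mu k.
    apply: eq_Lnorm => x /=; rewrite !patchE; case: ifP => // /set_mem Xx.
    by rewrite (koopman_indicB mXX tK).
  move=> h; apply: (@le_trans _ _ (norm_L2 XX mu k)); last first.
    apply: le_trans h _; rewrite -[leRHS]mule1 lee_wpmul2l // lee_fin.
  apply: le_trans (Lnorm1_le_Lnorm2 _ mkX).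
  rewrite integral_mkcond; apply: ge0_le_integral => //.
  - by move=> x _; rewrite patchE; case: ifP.
  - apply: (measurable_restrictT (fun x => `|k x|%:E) mXX).1.
    by apply/measurable_EFinP/measurable_funTS/measurableT_comp.
  - by apply/measurable_EFinP/measurableT_comp.
  - by move=> x _; rewrite !patchE; case: ifP => //; rewrite normr0.
have mkA : measurable_fun A (fun x => `|k x|%:E).
  by apply/measurable_EFinP/measurable_funTS/measurableT_comp.
have le_kA : (\int[mu]_(x in A) `|k x|%:E <= (M * expR (- (omega * t)))%:E)%E.
  apply: le_trans le_k.
  have mk' : measurable_fun setT (fun x => `|k x|%:E).
    by apply/measurable_EFinP/measurableT_comp.
  rewrite -(ge0_integral_full mXX inv_mu) //.
  exact: ge0_subset_integral.
(* [weakly_correlated] asks only for an upper bound, so K t x A = p + k x may be replaced by p + |k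
   x|. *)
have le1 : (\int[mu]_(x in A) K t x A <=
    (p * p)%:E + (M * expR (- (omega * t)))%:E)%E.
  apply: (@le_trans _ _ (\int[mu]_(x in A) (p%:E + `|k x|%:E))%E).
    apply: ge0_le_integral => //.
    - exact/measurable_funTS/measurable_kernel.
    - exact: emeasurable_funD.
    - move=> x _; have [<- _] := transition_fin t x mA.
      by rewrite -EFinD lee_fin -lerBlDl; exact: ler_norm.
  rewrite ge0_integralD //; last by move=> x _; rewrite lee_fin; case/andP: p01.
  by rewrite leeD // integral_cst // [X in (_ * X)%E]pE.
rewrite lerBlDl -lee_fin EFinD expr2.
rewrite fineK // ge0_fin_numE ?integral_ge0 // (le_lt_trans le1) //.
by rewrite -EFinD ltry.
Qed.

End Trajectory.
End Mixing.

(** * The three sampling modes *)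

Section SamplingModes.
Context {R : realType} {n q : nat}.
Variables (XX : set 'rV[R]_n) (b : 'rV[R]_n -> 'rV[R]_n)
  (sigma : 'rV[R]_n -> 'M[R]_(n, q)) (mu : probability (Rn R n) R)
  (K : R -> R.-pker (Rn R n) ~> (Rn R n)) (mode : sampling R).
Hypotheses (mXX : measurable (XX : set (Rn R n)))
  (modeH : sampling_assumption XX b sigma mu K mode).

Let S : @sampler R n :=
  fun m d Omega P x => is_sample XX b sigma mu mode (P : probability Omega R) x.

Lemma sample_identically_distributed : identically_distributed mu S.
Proof.
move=> m d Omega P x [xX]; move: modeH.
case: mode => [||dt M omega] /= modeH' Sx k; [exact: Sx.1|exact: Sx.1|].
have [Fil [W [X [solX inX law0 xE]]]] := Sx.
have [tK [inv _] dt0 _ _] := modeH'.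
have -> : x k = X (k%:R * dt) by apply/funext => w.
apply: (solution_has_law mXX tK inv solX inX law0).
by rewrite mulr_ge0 // ltW.
Qed.

Lemma sample_weakly_correlated : weakly_correlated mu S.
Proof.
move=> A mA; move: modeH.
(* Off-diagonal covariances vanish and each diagonal term p - p^2 is at most 1, so c = 1. *)
have iid_case m d (Omega : measurableType d) (P : probability Omega R)
    (x : 'I_m -> Omega -> 'rV[R]_n) : iid P mu x ->
    \sum_k \sum_l (fine (P (x k @^-1` A `&` x l @^-1` A)) - fine (mu A) ^+ 2)
    <= 1 * m%:R.
  move=> iidx; rewrite mul1r -[m in leRHS]card_ord -sumr_const.
  apply: ler_sum => k _; rewrite (bigD1 k) //= big1 ?addr0 => [|l lk].
    rewrite setIid (iidx.1 k).2 //.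
    have p1 : fine (mu A) <= 1.
      by rewrite -lee_fin fineK ?fin_num_measure // probability_le1.
    by apply: le_trans p1; rewrite gerBl sqr_ge0.
  rewrite (iid_pair mA iidx) 1?eq_sym // fineM ?fin_num_measure //.
  by rewrite expr2 subrr.
rewrite /S; case: mode => [||dt M omega] /= modeH'.
- by exists 1 => // m d Omega P x [_]; exact: iid_case.
- by exists 1 => // m d Omega P x [_]; exact: iid_case.
have [tK [inv _] dt0 [M1 omega0] stable] := modeH'.
have M0 : 0 <= M by rewrite (le_trans ler01).
(* The decay over one sampling step: samples k <= l are l - k steps apart, so their covariance is at
   most M r^(l - k). *)
pose r := expR (- (omega * dt)).
have r0 : 0 <= r by exact: expR_ge0.
have r1 : r < 1 by rewrite -expR0 ltr_expR oppr_lt0 mulr_gt0.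
exists (2 * M * (1 - r)^-1).
  by rewrite !mulr_ge0 // invr_ge0 subr_ge0 ltW.
move=> m d Omega P x [_ [Fil [W [X [solX inX law0 xE]]]]].
have xXE k : x k = X (k%:R * dt) by apply/funext => w.
apply: sum_geometric_dist_le => // [k l|k l kl]; first by rewrite setIC.
rewrite !xXE.
have -> : l%:R * dt = k%:R * dt + (l - k)%:R * dt.
  by rewrite -mulrDl -natrD subnKC.
have -> : r ^+ (l - k) = expR (- (omega * ((l - k)%:R * dt))).
  by rewrite /r -expRM_natl; congr expR; ring.
apply: (solution_correlation mXX tK inv solX inX law0 stable) => //;
  by rewrite mulr_ge0 // ltW.
Qed.

Lemma sample_L1_lln (h : Rn R n -> R) :
  mu.-integrable setT (EFin \o h) -> L1_lln mu S h.
Proof.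
apply: L1_lln_integrable; first exact: sample_identically_distributed.
exact: sample_weakly_correlated.
Qed.

Lemma generator_in_L2 f g : generator XX b sigma mu K mode f g ->
  in_L2 XX mu f /\ in_L2 XX mu g.
Proof. by rewrite /generator; case: mode => [|| ? ? ?] []. Qed.

End SamplingModes.

(** * Empirical and exact Gram matrices *)

Section Gram.
Context {R : realType} {n : nat}.
Variables (XX : set 'rV[R]_n) (mu : probability (Rn R n) R).
Hypothesis mXX : measurable (XX : set (Rn R n)).

(** Observables are arbitrary off XX, where they need not even be measurable. Cutting them off gives
    an integrable function on the whole space that is unchanged at the samples, all of which lie in
    XX. *)
Definition restricted_mul (f g : 'rV[R]_n -> R) (y : Rn R n) : R :=
  (f \_ XX) y * (g \_ XX) y.

Lemma restricted_mulE f g y : XX y -> restricted_mul f g y = f y * g y.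
Proof. by move=> Xy; rewrite /restricted_mul !patchE mem_set. Qed.

Lemma integrable_restricted_mul f g : in_L2 XX mu f -> in_L2 XX mu g ->
  mu.-integrable setT (EFin \o restricted_mul f g).
Proof. by move=> ? ?; apply/Lfun1_integrable; exact: Lfun2_mul_Lfun1. Qed.

Lemma inner_L2E f g : inner_L2 XX mu f g = \int[mu]_y restricted_mul f g y.
Proof.
rewrite /inner_L2 Rintegral_mkcond; apply: eq_Rintegral => y _.
by rewrite /restricted_mul !patchE; case: ifP; rewrite ?mulr0.
Qed.

Lemma Rintegral_sum d (T : measurableType d) (nu : {measure set T -> \bar R})
    (I : Type) (s : seq I) (f : I -> T -> R) :
  (forall i, nu.-integrable setT (EFin \o f i)) ->
  nu.-integrable setT (EFin \o (fun y => \sum_(i <- s) f i y)) /\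
  \int[nu]_y (\sum_(i <- s) f i y) = \sum_(i <- s) \int[nu]_y f i y.
Proof.
move=> fi; elim: s => [|i s [IHi IH]].
  under [X in EFin \o X]eq_fun do rewrite big_nil.
  under eq_Rintegral do rewrite big_nil.
  by rewrite big_nil /Rintegral integral0; split=> //; exact: integrable0.
under [X in EFin \o X]eq_fun do rewrite big_cons.
under eq_Rintegral do rewrite big_cons.
rewrite big_cons RintegralD // IH; split=> //.
by have := integrableD measurableT (fi i) IHi.
Qed.

(** A row v with v C = 0 gives s = sum_j v_j psi_j with integral of s^2 equal to v C v^T = 0. Hence
    s = 0 almost everywhere, and freeness forces v = 0. *)
Lemma galerkin_C_unit N (psi : 'I_N -> 'rV[R]_n -> R) :
  (forall j, in_L2 XX mu (psi j)) -> free_in_L2 XX mu psi ->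
  galerkin_C XX mu psi \in unitmx.
Proof.
move=> L2psi free; rewrite -row_free_unit -kermx_eq0.
apply/eqP/row_matrixP => i; rewrite row0.
set C := galerkin_C XX mu psi; set v := row i (kermx C).
have vC : v *m C = 0 by rewrite -row_mul mulmx_ker row0.
pose s (y : Rn R n) : R := \sum_j v ord0 j * (psi j \_ XX) y.
have ms : measurable_fun setT s.
  apply: measurable_sum => j; apply: measurable_funM => //.
  by have := sub_Lfun_mfun (L2psi j); rewrite inE.
have int_jk j k : mu.-integrable setT
    (EFin \o (fun y => v ord0 j * v ord0 k * restricted_mul (psi j) (psi k) y)).
  have := integrableZl measurableT (v ord0 j * v ord0 k)
    (integrable_restricted_mul (L2psi j) (L2psi k)).
  by [].
have s2E y : s y ^+ 2 = \sum_j \sum_k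
    v ord0 j * v ord0 k * restricted_mul (psi j) (psi k) y.
  rewrite expr2 {1}/s mulr_suml; apply: eq_bigr => j _.
  rewrite mulr_sumr; apply: eq_bigr => k _; rewrite /restricted_mul; ring.
have inner_sum j := Rintegral_sum (index_enum 'I_N) (int_jk j).
have [is2 Is2] := Rintegral_sum (index_enum 'I_N) (fun j => (inner_sum j).1).
have s20 : \int[mu]_y (s y ^+ 2) = 0.
  under eq_Rintegral do rewrite s2E.
  rewrite Is2; under eq_bigr do rewrite (inner_sum _).2.
  rewrite exchange_big big1 //= => k _.
  have vCk : \sum_j v ord0 j * inner_L2 XX mu (psi j) (psi k) = 0.
    have /rowP/(_ k) := vC; rewrite mxE [RHS]mxE; apply: etrans.
    by apply: eq_bigr => j _; rewrite [C _ _]mxE.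
  apply: (@etrans _ _
    (v ord0 k * \sum_j v ord0 j * inner_L2 XX mu (psi j) (psi k))).
    rewrite mulr_sumr; apply: eq_bigr => j _.
    rewrite RintegralZl ?inner_L2E //; first by ring.
    exact: integrable_restricted_mul.
  by rewrite vCk mulr0.
have is2' : mu.-integrable setT (EFin \o (fun y => s y ^+ 2)).
  by under [X in EFin \o X]eq_fun do rewrite s2E.
have s2_ae : ae_eq mu setT (fun y => (s y ^+ 2)%:E) (cst 0%E).
  apply/(ae_eq_integral_abs mu measurableT).
    by apply/measurable_EFinP; exact: measurable_funX.
  under eq_integral do rewrite gee0_abs ?lee_fin ?sqr_ge0 //.
  by rewrite -[LHS]fineK ?integrable_fin_num // -/(Rintegral _ _ _) s20.
apply/rowP => j; rewrite [RHS]mxE; apply: (free (fun j => v ord0 j)).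
have aeF := ae_filter_ringOfSetsType mu.
apply: (filterS _ s2_ae) => y /(_ I) [] /eqP; rewrite sqrf_eq0 => /eqP sy Xy.
by rewrite -[RHS]sy; apply: eq_bigr => k _; rewrite patchE mem_set.
Qed.

Lemma empirical_CE N (psi : 'I_N -> 'rV[R]_n -> R) m
    (x : 'I_m -> 'rV[R]_n) j k :
  (forall l, XX (x l)) ->
  empirical_C psi x j k =
    m%:R^-1 * \sum_l restricted_mul (psi j) (psi k) (x l).
Proof.
move=> xX; rewrite mxE summxE; congr (_ * _); apply: eq_bigr => l _.
by rewrite mxE big_ord1 !mxE restricted_mulE.
Qed.

Lemma empirical_AE N (psi Lpsi : 'I_N -> 'rV[R]_n -> R) m
    (x : 'I_m -> 'rV[R]_n) j k :
  (forall l, XX (x l)) ->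
  empirical_A psi Lpsi x j k =
    m%:R^-1 * \sum_l restricted_mul (psi j) (Lpsi k) (x l).
Proof.
move=> xX; rewrite mxE summxE; congr (_ * _); apply: eq_bigr => l _.
by rewrite mxE big_ord1 !mxE restricted_mulE.
Qed.

End Gram.

(** * Measurability and probability of the event *)

Lemma measurable_sample_fun (R : realType) n q (XX : set 'rV[R]_n) b
    (sigma : 'rV[R]_n -> 'M[R]_(n, q)) mu K mode
    m d (Omega : measurableType d) (P : probability Omega R)
    (x : 'I_m -> Omega -> 'rV[R]_n) (f g : 'rV[R]_n -> R) :
  measurable (XX : set (Rn R n)) -> sampling_assumption XX b sigma mu K mode ->
  is_sample XX b sigma mu mode P x -> in_L2 XX mu f -> in_L2 XX mu g ->
  measurable_fun setT
    (fun w => m%:R^-1 * \sum_l restricted_mul XX f g (x l w)).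
Proof.
move=> mXX modeH Sx L2f L2g; apply: measurable_funM => //.
have mh : measurable_fun setT (restricted_mul XX f g).
  apply/measurable_EFinP; apply: (measurable_int mu).
  exact: integrable_restricted_mul.
apply: measurable_sum => l.
have S_law := sample_identically_distributed mXX modeH.
exact: (measurable_comp_sample S_law Sx l mh).
Qed.

Theorem corollary18 (R : realType) (n nc q N : nat)
  (XX : set 'rV[R]_n) (mXX : measurable (XX : set (Rn R n)))
  (F : 'rV[R]_n -> 'rV[R]_n) (G : 'I_nc -> 'rV[R]_n -> 'rV[R]_n)
  (sigma : 'rV[R]_n -> 'M[R]_(n, q))
  (lipF : [locally [lipschitz F x | x in XX]])
  (lipG : forall i, [locally [lipschitz G i x | x in XX]])
  (mu : 'I_nc.+1 -> probability (Rn R n) R)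
  (K : 'I_nc.+1 -> R -> R.-pker (Rn R n) ~> (Rn R n))
  (mode : 'I_nc.+1 -> sampling R)
  (sampleH : forall i, sampling_assumption XX
     (control_drift F G (basis_control i)) sigma (mu i) (K i) (mode i))
  (psi : 'I_N -> 'rV[R]_n -> R) (Lpsi : 'I_nc.+1 -> 'I_N -> 'rV[R]_n -> R)
  (free_psi : forall i, free_in_L2 XX (mu i) psi)
  (psi_dom : forall i j, generator XX
     (control_drift F G (basis_control i)) sigma (mu i) (K i) (mode i)
     (psi j) (Lpsi i j))
  (T eps delta : R) (T_gt0 : 0 < T) (eps_gt0 : 0 < eps)
  (delta01 : 0 < delta < 1) (z0 : 'cV[R]_N)
  (x0 : 'rV[R]_n) (x0XX : XX x0)
  (alpha : R -> 'rV[R]_nc)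
  (alphaH : admissible_control XX F G sigma T x0 alpha) :
  exists m0 : nat, forall m : nat, (m0 <= m)%N ->
  forall (d : measure_display) (Omega : measurableType d)
    (P : probability Omega R)
    (x : 'I_nc.+1 -> 'I_m -> Omega -> 'rV[R]_n),
  (forall i, is_sample XX (control_drift F G (basis_control i)) sigma (mu i)
     (mode i) P (x i)) ->
  let invertible (w : Omega) : Prop :=
    forall i, empirical_C psi (fun k => x i k w) \in unitmx in
  forall (z : R -> 'cV[R]_N) (zt : Omega -> R -> 'cV[R]_N),
  linear_ode_solution T
    (fun t => control_affine
       (fun i => galerkin_L XX (mu i) psi (Lpsi i)) (alpha t)) z0 z ->
  (forall w, invertible w ->
     linear_ode_solution T
       (fun t => control_affine
          (fun i => empirical_L psi (Lpsi i) (fun k => x i k w)) (alpha t))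
       z0 (zt w)) ->
  forall t : R, 0 <= t <= T ->
  let event := [set w | invertible w /\ norm2 (z t - zt w t) <= eps] in
  measurable event /\ ((1 - delta)%:E <= P event)%E.
Proof.
have T0 := ltW T_gt0; case/andP: delta01 => delta0 delta1.
have [malpha [a a0 balpha]] := admissible_control_bounded alphaH.
have L2psi i j : in_L2 XX (mu i) (psi j) := (generator_in_L2 (psi_dom i j)).1.
have L2Lpsi i j : in_L2 XX (mu i) (Lpsi i j) :=
  (generator_in_L2 (psi_dom i j)).2.
have uC i : galerkin_C XX (mu i) psi \in unitmx.
  by apply: galerkin_C_unit => // j; exact: L2psi.
pose A i := galerkin_A XX (mu i) psi (Lpsi i).
have [eta eta0 Heta] := edmd_stable A z0 T0 a0 eps_gt0 malpha balpha uC.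
(* All entries of all matrices in one finite index: the boolean selects A (true) or C (false), then
   come the system, the row and the column. *)
pose J : finType := (bool * 'I_nc.+1 * 'I_N * 'I_N)%type.
pose phi (tau : J) : 'rV[R]_n -> R :=
  if tau.1.1.1 then Lpsi tau.1.1.2 tau.2 else psi tau.2.
pose h (tau : J) := restricted_mul XX (psi tau.1.2) (phi tau).
have L2phi tau : in_L2 XX (mu tau.1.1.2) (phi tau).
  by rewrite /phi; case: ifP => _; [exact: L2Lpsi|exact: L2psi].
have ih tau : (mu tau.1.1.2).-integrable setT (EFin \o h tau).
  exact: integrable_restricted_mul.
(* Chosen so that the #|J| mean deviations add up to at most eta * delta, as Markov's inequality
   requires; the 1 covers an empty [J], that is N = 0. *)
pose eta' := eta * delta / (#|J|%:R + 1).
have J1 : 0 < #|J|%:R + 1 :> R by rewrite ltr_wpDl.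
have eta'0 : 0 < eta' by rewrite divr_gt0 ?mulr_gt0.
have /choice[m_ Hm] tau :=
  (sample_L1_lln mXX (sampleH tau.1.1.2) (ih tau)).2 _ eta'0.
exists (\max_tau m_ tau) => m mm d Omega P x Sx invertible z zt solz solzt t tT.
have xXX i k w : XX (x i k w) := (Sx i).1 k w.
pose C' w i := empirical_C psi (fun k => x i k w).
pose A' w i := empirical_A psi (Lpsi i) (fun k => x i k w).
pose f (tau : J) w := m%:R^-1 * \sum_k h tau (x tau.1.1.2 k w).
have C'E w i j k : C' w i j k = f (false, i, j, k) w.
  by rewrite /C' (empirical_CE (XX := XX)).
have A'E w i j k : A' w i j k = f (true, i, j, k) w.
  by rewrite /A' (empirical_AE (XX := XX)).
have mf tau : measurable_fun setT (f tau).
  exact: (measurable_sample_fun mXX (sampleH _) (Sx _)).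
(* [zt] is not assumed measurable in w; its continuity with respect to the finitely many measurable
   entries [f] takes the place of that. *)
have stable w e : 0 < e -> invertible w -> exists2 r, 0 < r &
    forall w', (forall tau, `|f tau w' - f tau w| <= r) -> invertible w' /\
    \sum_j `|zt w' t j ord0 - zt w t j ord0| <= e.
  move=> e0 iw.
  have [r r0 Hr] := edmd_stable (A' w) z0 T0 a0 e0 malpha balpha iw.
  exists r => // w' ww'.
  have [||uC' Hz] := Hr (C' w') (A' w').
  - by move=> i j k; rewrite [_ j k]C'E [X in _ - X]C'E.
  - by move=> i j k; rewrite [_ j k]A'E [X in _ - X]A'E.
  by split=> //; apply: Hz => //; exact: solzt.
(* Invertibility is an open condition on the entries, so its complement satisfies the closedness
   hypothesis; the tolerance 1 is immaterial here. *)
have m_inv : measurable invertible.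
  rewrite -(setCK invertible); apply: measurableC.
  apply: (measurable_of_approx mf measurableT) => // w _ H iw.
  have [r r0 Hr] := stable w 1 ltr01 iw.
  by have [w' niw' /Hr[/niw']] := H r r0.
(* The event is closed only relative to [invertible], since [zt] is unconstrained elsewhere. *)
move=> event; have m_event : measurable event.
  apply: (measurable_of_approx mf m_inv) => [w []//|w iw H]; split=> //.
  apply: norm2_le_closed; first exact: ltW.
  move=> e e0; have [r r0 Hr] := stable w e e0 iw.
  have [w' [_ ew'] /Hr[_ le_e]] := H r r0.
  exists (z t - zt w' t) => //; apply: le_trans le_e.
  rewrite le_eqVlt; apply/predU1P; left; apply: eq_bigr => j _.
  by rewrite !mxE; congr (`|_|); ring.
split=> //.
pose dev tau w := `|f tau w - \int[mu tau.1.1.2]_y h tau y|.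
have mdev tau : measurable_fun setT (dev tau).
  by apply: measurableT_comp => //; exact: measurable_funB.
have E_dev tau : (\int[P]_w (dev tau w)%:E <= eta'%:E)%E.
  apply: Hm; last exact: Sx.
  by apply: leq_trans mm; exact: leq_bigmax.
(* The bad event. Thresholding the sum of the deviations at eta avoids a union bound and controls
   every entry off [B]. *)
pose B := [set w | eta <= \sum_tau dev tau w].
have msum : measurable_fun setT (fun w => \sum_tau dev tau w).
  exact: measurable_sum.
have dev0 tau w : 0 <= dev tau w by exact: normr_ge0.
have sum0 w : 0 <= \sum_tau dev tau w by apply: sumr_ge0.
have mB : measurable B.
  have := measurable_fun_ler (measurable_cst eta) msum measurableT.
  by move=> /(_ [set true] I); rewrite setTI.
have PB : (P B <= delta%:E)%E.
  rewrite -(@lee_pmul2l _ eta%:E) ?lte_fin //.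
  have mE : measurable_fun setT (fun w => (\sum_tau dev tau w)%:E).
    exact/measurable_EFinP.
  have := le_integral_abse P measurableT mE eta0.
  have -> : setT `&` [set w | (eta%:E <= `|(\sum_tau dev tau w)%:E|)%E] = B.
    by rewrite setTI; apply/seteqP; split=> w /=; rewrite lee_fin ger0_norm.
  move=> /le_trans; apply.
  under eq_integral do rewrite gee0_abs ?lee_fin // -sumEFin.
  rewrite ge0_integral_sum //; first last.
  - by move=> tau w _; rewrite lee_fin.
  - by move=> tau; apply/measurable_EFinP; exact: mdev.
  apply: le_trans (lee_sum _ (fun tau _ => E_dev tau)) _.
  rewrite sumEFin sumr_const -EFinM lee_fin -[_ *+ _]mulr_natl /eta'.
  rewrite mulrCA ler_piMr ?mulr_ge0 ?(ltW eta0) ?(ltW delta0) //.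
  by rewrite ler_pdivrMr // mul1r lerDl.
have subE : ~` B `<=` event.
  move=> w /negP; rewrite -ltNge => Bw.
  have dev_le tau : dev tau w <= eta.
    apply: ltW; apply: le_lt_trans Bw; rewrite (bigD1 tau) //= lerDl.
    exact: sumr_ge0.
  have [||iw Hz] := Heta (C' w) (A' w).
  - move=> i j k; rewrite [_ j k]C'E mxE inner_L2E.
    exact: (dev_le (false, i, j, k)).
  - move=> i j k; rewrite [_ j k]A'E mxE inner_L2E.
    exact: (dev_le (true, i, j, k)).
  split=> //; apply: le_trans (norm2_le_sum _) _.
  have := Hz z (zt w) solz (solzt w iw) t tT; apply: le_trans.
  rewrite le_eqVlt; apply/predU1P; left; apply: eq_bigr => j _.
  by rewrite !mxE distrC.
apply: (@le_trans _ _ (P (~` B))); last first.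
  by apply: le_measure; rewrite ?inE //; exact: measurableC.
rewrite probability_setC // EFinB; exact: leeB.
Qed.
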